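(* Let $n\ge1$, $\varepsilon\neq0$, let $\Omega\subseteq\mathbb{R}^{2n}$ be a bounded domain and $H\in C^1(\Omega)$. Let $u\in C^3(\Omega)$ be a solution in $\Omega$ of $$\operatorname{div}\left(\frac{Du+X}{\sqrt{\varepsilon^2+|Du+X|^2}}\right)=H,$$ and let $\tilde\Omega\Subset\Omega$ be a domain. Then for every domain $\hat\Omega\Subset\tilde\Omega$ there exists a constant $C>0$ depending only on $n$, $\varepsilon$, $d(\partial\hat\Omega,\partial\tilde\Omega)$, $\|u\|_{L^\infty(\tilde\Omega)}$, $\|H\|_{C^1(\tilde\Omega)}$ and $\|X\|_{L^\infty(\tilde\Omega)}$ such that $$\|Du\|_{L^\infty(\hat\Omega)}\le C,$$ where $d(\partial\hat\Omega,\partial\tilde\Omega)$ is the Euclidean distance between $\partial\hat\Omega$ and $\partial\tilde\Omega$.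
   Context: Points of $\mathbb{R}^{2n}$ are written $z=(x,y)$ with $x,y\in\mathbb{R}^n$, and $X:\mathbb{R}^{2n}\to\mathbb{R}^{2n}$ is $X(x,y)=(-y,x)$. $D$ is the Euclidean gradient, $|\cdot|$ the Euclidean norm, $\operatorname{div}$ the Euclidean divergence. *)

(* Defs.v *)
(* R^{2n} is modelled as 'rV[R]_(n + n), whose first
   n coordinates are x and last n coordinates are y. *)
From HB Require Import structures.
From mathcomp Require Import all_boot all_order all_algebra.
From mathcomp Require Import all_classical all_reals all_analysis.
Set Implicit Arguments. Unset Strict Implicit. Unset Printing Implicit Defensive.
Import Order.TTheory GRing.Theory Num.Theory.
Import numFieldNormedType.Exports.
Local Open Scope classical_set_scope.
Local Open Scope ring_scope.

Section Defs.
Variables (R : realType) (n : nat).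
Notation V := 'rV[R]_(n + n).

Definition ebasis (i : 'I_(n + n)) : V := delta_mx 0 i.

Definition partial (i : 'I_(n + n)) (f : V -> R) : V -> R :=
  fun z => 'D_(ebasis i) f z.

Definition grad (f : V -> R) (z : V) : V := \row_i partial i f z.

Definition enorm (v : V) : R := Num.sqrt (\sum_i v 0 i ^+ 2).

Definition div (F : V -> V) (z : V) : R :=
  \sum_i partial i (fun w => F w 0 i) z.

Definition Xfield (z : V) : V :=
  \row_(i < n + n) match fintype.split i with
                   | inl j => - z 0 (rshift n j)
                   | inr j => z 0 (lshift n j)
                   end.

(* C^k(Omega): all partial derivatives of order <= k exist and are
   continuous at every point of Omega (Omega is open) *)
Fixpoint Ck (k : nat) (Om : set V) (f : V -> R) : Prop :=
  match k with
  | 0 => forall z, Om z -> {for z, continuous f}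
  | k'.+1 => (forall z, Om z -> {for z, continuous f}) /\
             (forall i z, Om z -> derivable f z (ebasis i)) /\
             (forall i, Ck k' Om (partial i f))
  end.

Definition ebounded (A : set V) : Prop :=
  exists M : R, forall z, A z -> enorm z <= M.

Definition domain (A : set V) : Prop :=
  open A /\ connected A /\ A !=set0.

Definition cc (A B : set V) : Prop :=
  compact (closure A) /\ closure A `<=` B.

Definition boundary (A : set V) : set V := closure A `\` interior A.

Definition set_dist (A B : set V) : R :=
  inf [set enorm (p - q) | p in A & q in B].

Definition supnorm (A : set V) (f : V -> R) : R :=
  sup [set `|f z| | z in A].

Definition supnormV (A : set V) (F : V -> V) : R :=
  sup [set enorm (F z) | z in A].

Definition C1norm (A : set V) (f : V -> R) : R :=
  supnorm A f + supnormV A (grad f).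

End Defs.

(* Main.v *)
(* Write e = |eps|, q = (Du + X) / e, nu = (1 + |q|^2)^(-1/2) and N = nu q. With
   the metric g_ij = delta_ij + q_i q_j, u is a graph of mean curvature H in a
   Heisenberg-type space in which the vertical translations are isometries, so
   the vertical component nu of the unit normal satisfies a Jacobi equation
     Lap nu = - (|A|^2 + Ric (N, N)) nu - nu N(H) <= const * nu,
   with Lap f = nu div (nu^-1 g^-1 Df). Here this is an elementary identity for
   A_ij = d_j N_i and the constant skew matrix B = curl X / (2 e).

   Korevaar's maximum principle then applies. Let
     phi = 1 - 2 |z - z0|^2 / r^2 + (u - u(z0)) / (2 |u|_oo + 1),
   so that phi(z0) = 1, phi <= 2 and phi < 0 on the boundary of the box of radius
   r. At an interior maximum of (exp (K phi) - 1) / nu one gets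
   K^2 |grad phi|_g^2 <= C1 K + C0, whereas |grad phi|_g^2 is bounded below once
   nu is small; choosing K large bounds nu from below at the maximum, hence at
   z0, and e / nu dominates |Du + X|. *)

Require Import Defs.
From HB Require Import structures.
From mathcomp Require Import all_boot all_order all_algebra.
From mathcomp Require Import all_classical all_reals all_analysis.
From mathcomp Require Import ring lra.
Set Implicit Arguments. Unset Strict Implicit. Unset Printing Implicit Defensive.
Import Order.TTheory GRing.Theory Num.Theory.
Import numFieldNormedType.Exports.
Local Open Scope classical_set_scope.
Local Open Scope ring_scope.

(** * Differential calculus *)

(** The obstacle is that [Du + X] is not a gradient: the matrix of first derivatives of [q] is not
    symmetric, so the trace of the square of [A] is not a sum of squares. Its skew part is however
    the constant [B], and the terms mixing [B] with the symmetric part are absorbed by completing a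
    square; the price, 4 |N B|^2, is bounded because |N| <= 1. No unbounded derivative of [u] may
    enter the estimates. In the Jacobi equation third derivatives assemble into N(H). In the
    Laplacian of phi second derivatives assemble into the divergence of [N] or into the curl of [q],
    because D phi is [alpha * q] plus a field built from [X] and the position only. Since u is C^3,
    [N] is twice differentiable, which is what differentiating the equation once takes. Subtracting
    1 from the exponential gives the quotient the sign of phi, which forces its maximum into the
    interior. The final constant precedes the domains and functions, so every constant is an
    explicit expression in the prescribed bounds. *)

Lemma near_norm (R : realType) (V : normedModType R) (z : V) (P : V -> Prop) :
  (\forall y \near z, P y) ->
  exists2 d : R, 0 < d & forall k : V, `|k| < d -> P (k + z).
Proof.
move=> /nbhs_ballP[d /= d0 Hd]; exists d => // k kd; apply: Hd.
by rewrite -ball_normE /= opprD addrCA subrr addr0 normrN.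
Qed.

Lemma norm_near (R : realType) (V : normedModType R) (z : V) (P : V -> Prop)
    (d : R) : 0 < d -> (forall k : V, `|k| < d -> P (k + z)) ->
  \forall y \near z, P y.
Proof.
move=> d0 H; apply/nbhs_ballP; exists d => //= y.
by rewrite -ball_normE /= distrC => /H; rewrite subrK.
Qed.

Lemma differentiable_intro (R : realType) (V : normedModType R) (f : V -> R)
    (z : V) (L : {linear V -> R}) :
  continuous L ->
  (forall e, 0 < e -> \forall h \near 0, `|f (h + z) - f z - L h| <= e * `|h|) ->
  differentiable f z /\ forall h, 'd f z h = L h.
Proof.
move=> cL fL.
have E : f \o shift z = cst (f z) + L +o_ 0 id.
  apply/eqaddoP => e e0; near=> h.
  suff : `|f (h + z) - f z - L h| <= e * `|h| by rewrite !fctE/= opprD addrA.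
  by near: h; exact: fL.
have dL := diff_unique cL E.
by split=> [|h]; [apply/diff_locallyP; rewrite dL | rewrite dL].
Unshelve. all: by end_near. Qed.

Lemma differentiable_elim (R : realType) (V : normedModType R) (f : V -> R)
    (z : V) : differentiable f z -> forall e, 0 < e ->
  \forall h \near 0, `|f (h + z) - f z - 'd f z h| <= e * `|h|.
Proof.
move=> df e e0; have := diff_locally df => /eqaddoP/(_ e e0).
by apply: filterS => h; rewrite !fctE/= opprD addrA.
Qed.

Lemma differentiable_near_eq (R : realType) (V : normedModType R)
    (f g : V -> R) (z : V) :
  (\forall y \near z, f y = g y) -> differentiable f z -> differentiable g z.
Proof.
move=> fg df; have fgz := nbhs_singleton fg.
have fg0 : \forall h \near (0 : V), f (h + z) = g (h + z).
  have [d d0 Hd] := near_norm fg.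
  by apply: (norm_near d0) => k /Hd; rewrite addr0.
apply: (proj1 (@differentiable_intro _ _ g z ('d f z) (diff_continuous df) _)).
move=> e e0; have := differentiable_elim df e0.
by apply: filterS2 fg0 => h; rewrite -fgz => ->.
Qed.

Lemma is_derive_slice (R : realType) (V : normedModType R) (f : V -> R)
    (z v : V) (t : R) : derivable f (z + t *: v) v ->
  is_derive t 1 (fun s => f (z + s *: v)) ('D_v f (z + t *: v)).
Proof.
move=> df.
have E : (fun h : R => h^-1 *: (((fun s => f (z + s *: v)) \o shift t) (h *: 1) -
    f (z + t *: v))) =
  (fun h => h^-1 *: ((f \o shift (z + t *: v)) (h *: v) - f (z + t *: v))).
  apply/funext => h /=; congr (_ *: (f _ - _)).
  by rewrite [h *: 1]mulr1 scalerDl addrCA.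
by apply: DeriveDef; rewrite /derivable /derive E.
Qed.

(** The segment is parametrised by [t] in [0, 1] with the step [a] as a factor, so that [a] may have
    either sign or vanish. *)
Lemma mvt_slice (R : realType) (V : normedModType R) (f : V -> R) (z v : V)
    (a : R) : (forall t, 0 <= t <= 1 -> derivable f (z + (t * a) *: v) v) ->
  exists2 t, 0 < t < 1 & f (z + a *: v) - f z = a * 'D_v f (z + (t * a) *: v).
Proof.
move=> df.
have D (t : R) : 0 <= t <= 1 ->
   is_derive t 1 (fun s => f (z + (s * a) *: v)) (a * 'D_v f (z + (t * a) *: v)).
  move=> /df /is_derive_slice D1.
  have D2 : is_derive t 1 (fun s : R => s * a) a.
    by apply: is_derive_eq; rewrite scaler0 add0r [_ *: _]mulr1.
  rewrite mulrC.
  exact: (@is_derive1_comp R (fun s : R => f (z + s *: v)) (fun s : R => s * a)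
    t ('D_v f (z + (t * a) *: v)) a D1 D2).
have [] := @MVT R (fun s => f (z + (s * a) *: v))
   (fun t => a * 'D_v f (z + (t * a) *: v)) 0 1 ltr01.
- by move=> t; rewrite in_itv/= => /andP[t0 t1]; apply: D; rewrite !ltW.
- apply: derivable_within_continuous => t; rewrite in_itv/= => t01.
  by have [] := D t t01.
- move=> t; rewrite in_itv/= => t01.
  by rewrite mul1r mul0r scale0r addr0 subr0 mulr1 => ?; exists t.
Qed.

Lemma is_derive_difference (R : realType) (V : normedModType R) (f g : V -> R)
    (z v : V) (a b : R) : is_derive z v f a -> is_derive z v g b ->
  is_derive z v (fun y => f y - g y) (a - b).
Proof. by move=> fa gb; exact: (@is_deriveB R V R f g z v a b). Qed.

Lemma is_derive_translate (R : realType) (V : normedModType R) (f : V -> R)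
    (z a v : V) : derivable f (z + a) v ->
  is_derive z v (fun y => f (y + a)) ('D_v f (z + a)).
Proof.
have E : (fun h : R => h^-1 *: (((fun y => f (y + a)) \o shift z) (h *: v) -
    f (z + a))) =
  (fun h => h^-1 *: ((f \o shift (z + a)) (h *: v) - f (z + a))).
  by apply/funext => h /=; rewrite addrA.
by move=> df; apply: DeriveDef; rewrite /derivable /derive E.
Qed.

Section Schwarz.
Variables (R : realType) (V : normedModType R).
Implicit Types (f : V -> R) (z v w : V).

Let second_difference f z v w (h : R) :=
  f (z + h *: v + h *: w) - f (z + h *: v) - f (z + h *: w) + f z.

(** The mean value theorem along [v], applied to [f (y + h *: w) - f y], leaves a difference of two
    values of ['D_v f] near [z]; both are then expanded to first order at [z]. *)
Lemma second_difference_approx f z v w :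
  (\forall y \near z, derivable f y v) -> differentiable ('D_v f) z ->
  forall e, 0 < e -> \forall h \near (0 : R),
    `|second_difference f z v w h - h ^+ 2 * 'D_w ('D_v f) z|
      <= e * h ^+ 2 * (`|w| + 2 * `|v|).
Proof.
move=> dfn dg e e0; rewrite deriveE//; have := differentiable_elim dg e0.
set g := 'D_v f => G.
have [d d0 Hd] : exists2 d : R, 0 < d & forall k : V, `|k| < d ->
    derivable f (k + z) v /\ `|g (k + z) - g z - 'd g z k| <= e * `|k|.
  have [d1 d10 H1] := near_norm dfn; have [d2 d20 H2] := near_norm G.
  exists (Num.min d1 d2); first by rewrite lt_min d10.
  move=> k; rewrite lt_min => /andP[/H1 ? /H2]; by rewrite addr0.
have M0 : 0 < `|w| + `|v| + 1 by rewrite ltr_wpDl.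
apply: (@norm_near _ _ _ _ (d / (`|w| + `|v| + 1))); first by rewrite divr_gt0.
suff main (h : R) : `|h| < d / (`|w| + `|v| + 1) ->
    `|second_difference f z v w h - h ^+ 2 * 'd g z w|
      <= e * h ^+ 2 * (`|w| + 2 * `|v|) by move=> h /main; rewrite addr0.
rewrite ltr_pdivlMr// => hs.
(* [a] will be 1 or 0: the mean value point enters both shifted by [h *: w] and unshifted. *)
have B0 (t a : R) : 0 <= t <= 1 -> `|a| <= 1 ->
   `|(a * h) *: w + (t * h) *: v| <= `|h| * (`|a| * `|w| + `|v|).
  move=> /andP[t0 t1] a1; rewrite (le_trans (ler_normD _ _))// !normrZ ?normrM.
  rewrite mulrDr lerD//; first by rewrite mulrAC mulrC.
  rewrite ler_wpM2r// (ger0_norm t0).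
  by rewrite ler_piMl.
have B (t a : R) : 0 <= t <= 1 -> `|a| <= 1 ->
   `|(a * h) *: w + (t * h) *: v| < d.
  move=> t01 a1; apply: le_lt_trans (B0 _ _ t01 a1) _.
  apply: le_lt_trans hs; rewrite ler_wpM2l//.
  by have : `|a| * `|w| <= `|w| by [rewrite ler_piMl|]; lra.
have D (t : R) : 0 <= t <= 1 ->
    is_derive (z + (t * h) *: v) v (fun y => f (y + h *: w) - f y)
      (g (h *: w + (t * h) *: v + z) - g ((t * h) *: v + z)).
  move=> t01.
  have D0 : derivable f ((t * h) *: v + z) v.
    apply: (proj1 (Hd _ _)).
    by have := B t 0 t01; rewrite mul0r scale0r add0r; apply; rewrite normr0.
  have D1 : derivable f (h *: w + (t * h) *: v + z) v.
    apply: (proj1 (Hd _ _)).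
    by have := B t 1 t01; rewrite mul1r; apply; rewrite normr1.
  rewrite [z + _]addrC; apply: (@is_derive_difference _ _ (fun y => f (y + h *: w)) f);
    last exact: derivableP.
  have E : h *: w + (t * h) *: v + z = (t * h) *: v + z + h *: w.
    by rewrite -addrA addrC.
  by rewrite E; apply: is_derive_translate; rewrite -E.
have [t t01] := @mvt_slice _ _ (fun y => f (y + h *: w) - f y) z v h
   (fun t t01 => @ex_derive _ _ _ _ _ _ _ (D t t01)).
have {}t01 : 0 <= t <= 1 by case/andP: t01 => ? ?; rewrite !ltW.
rewrite (@derive_val _ _ _ _ _ _ _ (D t t01)) => E.
have -> : second_difference f z v w h =
    f (z + h *: v + h *: w) - f (z + h *: v) - (f (z + h *: w) - f z).
  by rewrite /second_difference opprB !addrA; ring.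
rewrite E.
have n1 : `|1 : R| <= 1 by rewrite normr1.
have n0 : `|0 : R| <= 1 by rewrite normr0.
have LE a b : 'd g z (a *: w + b *: v) = a * 'd g z w + b * 'd g z v.
  by rewrite linearD !linearZ.
have := (Hd _ (B t 1 t01 n1)).2; have := (Hd _ (B t 0 t01 n0)).2.
rewrite !LE mul1r mul0r scale0r add0r mul0r add0r.
have := B0 t 1 t01 n1; have := B0 t 0 t01 n0.
rewrite normr1 normr0 !mul1r !mul0r scale0r !add0r.
set k1 := h *: w + (t * h) *: v; set k0 := (t * h) *: v => b0 b1 g0 g1.
have {}g0 := le_trans g0 (ler_wpM2l (ltW e0) b0).
have {}g1 := le_trans g1 (ler_wpM2l (ltW e0) b1).
(* The [v] parts of the two expansions cancel, so the unknown [t] disappears from the main term. *)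
have -> : h * (g (k1 + z) - g (k0 + z)) - h ^+ 2 * ('d g z) w =
  h * ((g (k1 + z) - g z - (h * ('d g z) w + (t * h) * ('d g z) v)) -
       (g (k0 + z) - g z - (t * h) * ('d g z) v)).
  by ring.
rewrite normrM -[h ^+ 2]real_normK ?num_real//.
have -> : e * `|h| ^+ 2 * (`|w| + 2 * `|v|) =
  `|h| * (e * (`|h| * (`|w| + `|v|)) + e * (`|h| * `|v|)) by ring.
rewrite ler_wpM2l//.
by rewrite (le_trans (ler_normB _ _))// lerD.
Qed.

(** Young's form of the theorem: the second difference is symmetric in [v] and [w], and each mixed
    derivative is its limit after division by [h ^+ 2]. Differentiability of the first derivatives
    at one point suffices, so continuity of second derivatives is never tracked. *)
Lemma schwarz f z v w :
  (\forall y \near z, derivable f y v) -> (\forall y \near z, derivable f y w) ->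
  differentiable ('D_v f) z -> differentiable ('D_w f) z ->
  'D_w ('D_v f) z = 'D_v ('D_w f) z.
Proof.
move=> fv fw dv dw.
apply/eqP; rewrite -subr_eq0 -normr_le0; apply/ler_addgt0Pr => e e0.
rewrite add0r.
(* The error factors of the two approximations add up to [M - 1]; the 1 keeps [M] positive. *)
pose M := 3 * (`|v| + `|w|) + 1.
have M0 : 0 < M by rewrite /M ltr_wpDl// mulr_ge0// addr_ge0.
have eM : 0 < e / M by rewrite divr_gt0.
have [d1 d10 H1] := near_norm (@second_difference_approx f z v w fv dv _ eM).
have [d2 d20 H2] := near_norm (@second_difference_approx f z w v fw dw _ eM).
pose d := Num.min d1 d2; have d0 : 0 < d by rewrite lt_min d10.
pose h := d / 2; have h0 : 0 < h by rewrite divr_gt0.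
have : `|h| < d by rewrite gtr0_norm// /h; lra.
rewrite lt_min => /andP[/H1 + /H2].
rewrite addr0.
have -> : second_difference f z w v h = second_difference f z v w h.
  by rewrite /second_difference [z + h *: w + h *: v]addrAC; ring.
move: (second_difference f z v w h) ('D_w ('D_v f) z) ('D_v ('D_w f) z).
move=> S a b h1 h2.
have h20 : 0 < h ^+ 2 by rewrite exprn_gt0.
rewrite -(ler_pM2l h20) -(ger0_norm (ltW h20)) -normrM.
have -> : h ^+ 2 * (a - b) = (S - h ^+ 2 * b) - (S - h ^+ 2 * a) by ring.
rewrite (le_trans (ler_normB _ _))// (le_trans (lerD h2 h1))//.
rewrite (ger0_norm (ltW h20)).
have -> : e / M * h ^+ 2 * (`|v| + 2 * `|w|) + e / M * h ^+ 2 * (`|w| + 2 * `|v|)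
  = h ^+ 2 * (e / M * (M - 1)) by rewrite /M; ring.
rewrite ler_pM2l// mulrBr mulr1 divfK ?gt_eqF//.
by rewrite gerBl ltW.
Qed.

End Schwarz.

Section LocalMax.
Variables (R : realType) (V : normedModType R) (f : V -> R) (z : V).
Hypothesis fmax : \forall y \near z, f y <= f z.
Hypothesis df : \forall y \near z, differentiable f y.

Let derive_le0 v : 'D_v f z <= 0.
Proof.
have dfz := nbhs_singleton df.
rewrite leNgt; apply/negP => c0.
have e0 : 0 < 'D_v f z / 2 / (`|v| + 1).
  by rewrite !divr_gt0// ltr_wpDl.
have [d1 d10 H1] := near_norm (differentiable_elim dfz e0).
have [d2 d20 H2] := near_norm fmax.
pose d := Num.min d1 d2; have d0 : 0 < d by rewrite lt_min d10.
have v0 : 0 < `|v| + 1 by rewrite ltr_wpDl.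
pose h := d / 2 / (`|v| + 1); have h0 : 0 < h by rewrite !divr_gt0.
have : `|h *: v| < d.
  rewrite normrZ gtr0_norm// /h mulrAC ltr_pdivrMr//.
  by have := normr_ge0 v; nra.
rewrite lt_min => /andP[/H1 + /H2]; rewrite addr0 linearZ/= -deriveE// normrZ.
rewrite (gtr0_norm h0) ler_norml => /andP[+ _].
set c := 'D_v f z => + fm.
have : c / 2 / (`|v| + 1) * (h * `|v|) < h * c.
  have -> : c / 2 / (`|v| + 1) * (h * `|v|) = h * (c / 2 * (`|v| / (`|v| + 1))).
    by field; rewrite gt_eqF.
  rewrite ltr_pM2l//.
  have c0' : 0 < c by [].
  have : `|v| / (`|v| + 1) <= 1 by rewrite ler_pdivrMr//; lra.
  set w := _ / _ => w1.
  have : c / 2 * w <= c / 2 * 1 by rewrite ler_pM2l// divr_gt0.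
  lra.
rewrite /GRing.scale/=; lra.
Qed.

Lemma derive_at_local_max v : 'D_v f z = 0.
Proof.
have dfz := nbhs_singleton df.
apply/eqP; rewrite eq_le derive_le0/=.
by have := derive_le0 (- v); rewrite !deriveE// linearN oppr_le0.
Qed.

(** If the second derivative were positive, the expansion of ['D_v f] from its value 0 at [z] would
    make it positive at every nearby [z + s *: v] with s > 0. The mean value theorem yields such a
    point where it is nonpositive, since [f] does not exceed [f z]. *)
Lemma derive2_at_local_max v :
  differentiable ('D_v f) z -> 'D_v ('D_v f) z <= 0.
Proof.
move=> dg; rewrite leNgt; apply/negP => c0.
have v0 : 0 < `|v| + 1 by rewrite ltr_wpDl.
have e0 : 0 < 'D_v ('D_v f) z / 2 / (`|v| + 1) by rewrite !divr_gt0.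
have [d1 d10 H1] := near_norm (differentiable_elim dg e0).
have [d2 d20 H2] := near_norm fmax.
have [d3 d30 H3] := near_norm df.
pose d := Num.min d1 (Num.min d2 d3).
have d0 : 0 < d by rewrite !lt_min d10 d20.
pose h := d / 2 / (`|v| + 1); have h0 : 0 < h by rewrite !divr_gt0.
have hd (t : R) : 0 <= t <= 1 -> `|(t * h) *: v| < d.
  move=> /andP[t0 t1].
  apply: (@le_lt_trans _ _ (h * `|v|)).
    by rewrite normrZ normrM (gtr0_norm h0) ger0_norm// ler_wpM2r// ler_piMl// ltW.
  rewrite /h mulrAC ltr_pdivrMr//.
  by have := normr_ge0 v; nra.
have [t t01] : exists2 t, 0 < t < 1 &
    f (z + h *: v) - f z = h * 'D_v f (z + (t * h) *: v).
  apply: mvt_slice => t /hd; rewrite !lt_min => /and3P[_ _ /H3].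
  by rewrite addrC => ?; exact: diff_derivable.
have {}t01 : 0 < t <= 1 by case/andP: t01 => -> /ltW.
have t0 : 0 < t by case/andP: t01.
have {}t01 : 0 <= t <= 1 by case/andP: t01 => /ltW -> ->.
have := hd _ t01; rewrite !lt_min => /and3P[/H1 + _ _].
have : 0 <= (1 : R) <= 1 by rewrite ler01 lexx.
move=> /hd; rewrite mul1r !lt_min => /and3P[_ /H2 + _].
rewrite ![_ + z]addrC addr0 linearZ/= -deriveE// derive_at_local_max subr0 => fm.
set c := 'D_v ('D_v f) z in c0 *; set D := 'D_v f _ => Dc fD.
have hD : D <= 0.
  by rewrite -(pmulr_rle0 _ h0) -fD subr_le0.
move: Dc; rewrite normrZ (@gtr0_norm _ (t * h)) ?mulr_gt0// ler_norml => /andP[+ _].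
have c0' : 0 < c by [].
have -> : c / 2 / (`|v| + 1) * (t * h * `|v|) =
    t * h * (c / 2 * (`|v| / (`|v| + 1))).
  by field; rewrite gt_eqF.
have : `|v| / (`|v| + 1) <= 1 by rewrite ler_pdivrMr//; lra.
set w := _ / _ => w1; rewrite /GRing.scale/=.
have : 0 < t * h * (c * (1 - w / 2)).
  by rewrite !mulr_gt0//; lra.
lra.
Qed.

End LocalMax.

(** * Partial derivatives *)

Section DifferentialRules.
Variables (R : realType) (V : normedModType R).
Implicit Types (f g : V -> R) (z v : V).

Lemma differentiable_add f g z : differentiable f z -> differentiable g z ->
  differentiable (fun y => f y + g y) z.
Proof. exact: differentiableD. Qed.

Lemma differentiable_opp f z : differentiable f z ->
  differentiable (fun y => - f y) z.
Proof. exact: differentiableN. Qed.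

Lemma differentiable_mul f g z : differentiable f z -> differentiable g z ->
  differentiable (fun y => f y * g y) z.
Proof. exact: differentiableM. Qed.

Lemma differentiable_big n (F : 'I_n -> V -> R) z :
  (forall i, differentiable (F i) z) ->
  differentiable (fun y => \sum_i F i y) z.
Proof. by move=> dF; rewrite -fct_sumE; exact: differentiable_sum. Qed.

Lemma differentiable_comp1 (phi : R -> R) f z :
  derivable phi (f z) 1 -> differentiable f z ->
  differentiable (fun y => phi (f y)) z.
Proof. by move=> /derivable1_diffP dphi df; exact: differentiable_comp. Qed.

Lemma derive_add f g z v : differentiable f z -> differentiable g z ->
  'D_v (fun y => f y + g y) z = 'D_v f z + 'D_v g z.
Proof. by move=> df dg; apply: deriveD; exact: diff_derivable. Qed.

Lemma derive_opp f z v : differentiable f z ->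
  'D_v (fun y => - f y) z = - 'D_v f z.
Proof. by move=> df; apply: deriveN; exact: diff_derivable. Qed.

Lemma derive_mul f g z v : differentiable f z -> differentiable g z ->
  'D_v (fun y => f y * g y) z = f z * 'D_v g z + g z * 'D_v f z.
Proof. by move=> df dg; apply: deriveM; exact: diff_derivable. Qed.

Lemma derive_big n (F : 'I_n -> V -> R) z v :
  (forall i, differentiable (F i) z) ->
  'D_v (fun y => \sum_i F i y) z = \sum_i 'D_v (F i) z.
Proof.
move=> dF; rewrite -fct_sumE; apply: derive_sum => i.
exact: diff_derivable.
Qed.

Lemma derive_const (c : R) z v : 'D_v (fun _ => c) z = 0.
Proof. exact: derive_cst. Qed.

Lemma derive_comp1 (phi : R -> R) f z v (a : R) :
  is_derive (f z) 1 phi a -> differentiable f z ->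
  'D_v (fun y => phi (f y)) z = a * 'D_v f z.
Proof.
move=> [dphi phiE] df; have dphi' := (derivable1_diffP _ _).1 dphi.
rewrite !deriveE//; last exact: differentiable_comp.
rewrite -[fun y => phi (f y)]/(phi \o f) diff_comp//= deriv1E//.
by rewrite derive1E phiE mulrC.
Qed.

End DifferentialRules.

Lemma rV_coord_norm (R : realType) d (x : 'rV[R]_d) i : `|x 0 i| <= `|x|.
Proof.
rewrite [leRHS]/Num.Def.normr/= mx_normrE.
exact: (le_bigmax _ (fun ij : 'I_1 * 'I_d => `|x ij.1 ij.2|) (0, i)).
Qed.

Lemma rV_norm_le (R : realType) d (x : 'rV[R]_d) (c : R) :
  0 <= c -> (forall i, `|x 0 i| <= c) -> `|x| <= c.
Proof.
move=> c0 H; rewrite [leLHS]/Num.Def.normr/= mx_normrE.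
by apply: bigmax_le => // -[i j] _ /=; rewrite ord1.
Qed.

Section Coordinates.
Variables (R : realType) (n : nat).
Notation V := 'rV[R]_(n + n).
Notation I := 'I_(n + n).
Implicit Types (f : V -> R) (z v : V) (U : set V) (i : I).

Lemma derive_direction f z v : differentiable f z ->
  'D_v f z = \sum_i v 0 i * partial i f z.
Proof.
move=> df; rewrite deriveE// {1}[v]row_sum_delta linear_sum/=.
apply: eq_bigr => i _; rewrite linearZ/= /partial deriveE//.
Qed.

Lemma differentiable_coordinate i z : differentiable (fun y : V => y 0 i) z.
Proof. exact: differentiable_coord. Qed.

Lemma derive_coordinate i z v : 'D_v (fun y : V => y 0 i) z = v 0 i.
Proof.
have := @derive_mx _ _ 1 (n + n) id z v (@derivable_id _ _ z v).
by rewrite derive_id => /matrixP/(_ 0 i); rewrite mxE => ->.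
Qed.

Lemma partial_coordinate i j z : partial i (fun y : V => y 0 j) z = (i == j)%:R.
Proof. by rewrite /partial derive_coordinate /ebasis mxE eqxx eq_sym. Qed.

Lemma partial_add f g i z : differentiable f z -> differentiable g z ->
  partial i (fun y => f y + g y) z = partial i f z + partial i g z.
Proof. exact: derive_add. Qed.

Lemma partial_opp f i z : differentiable f z ->
  partial i (fun y => - f y) z = - partial i f z.
Proof. exact: derive_opp. Qed.

Lemma partial_mul f g i z : differentiable f z -> differentiable g z ->
  partial i (fun y => f y * g y) z = f z * partial i g z + g z * partial i f z.
Proof. exact: derive_mul. Qed.

Lemma partial_mulr (c : R) f i z : differentiable f z ->
  partial i (fun y => f y * c) z = partial i f z * c.
Proof.
move=> df; rewrite (partial_mul _ df (differentiable_cst _ _)).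
by rewrite /partial derive_const mulr0 add0r mulrC.
Qed.

Lemma partial_mull (c : R) f i z : differentiable f z ->
  partial i (fun y => c * f y) z = c * partial i f z.
Proof.
move=> df; rewrite (partial_mul _ (differentiable_cst _ _) df).
by rewrite /partial derive_const mulr0 addr0.
Qed.

Lemma partial_big m (F : 'I_m -> V -> R) i z :
  (forall k, differentiable (F k) z) ->
  partial i (fun y => \sum_k F k y) z = \sum_k partial i (F k) z.
Proof. exact: derive_big. Qed.

Lemma partial_const (c : R) i z : partial i (fun _ : V => c) z = 0.
Proof. exact: derive_const. Qed.

Lemma partial_comp1 (phi : R -> R) f i z (a : R) :
  is_derive (f z) 1 phi a -> differentiable f z ->
  partial i (fun y => phi (f y)) z = a * partial i f z.
Proof. exact: derive_comp1. Qed.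

(** The increment from [z] to [h + z] is split into moves along single coordinates, and the mean
    value theorem turns each into a partial derivative at a point close to [z]. *)
Lemma C1_differentiable U f z : open U -> U z ->
  (forall i y, U y -> derivable f y (ebasis R i)) ->
  (forall i, {for z, continuous (partial i f)}) -> differentiable f z.
Proof.
move=> oU Uz df cf.
pose L v := \sum_i partial i f z * v 0 i.
have cL : continuous L.
  move=> v; apply: differentiable_continuous; apply: differentiable_big => i.
  by apply: differentiable_mul => //; exact: differentiable_coordinate.
have Llin : linear L.
  move=> a x y; rewrite /L scaler_sumr -big_split/=; apply: eq_bigr => i _.
  by rewrite !mxE mulrDr; congr (_ + _); rewrite mulrCA.
pose LM := GRing.isLinear.Build _ _ _ _ _ Llin.
pose Ll : {linear V -> R} := HB.pack L LM.
apply: (proj1 (@differentiable_intro _ _ f z Ll cL _)) => e e0.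
(* Each of the [n + n] moves costs at most [e'] times the norm of [h]; the 1 covers dimension
   zero. *)
pose e' := e / ((n + n)%:R + 1).
have n0 : 0 < (n + n)%:R + 1 :> R by rewrite ltr_wpDl.
have e'0 : 0 < e' by rewrite divr_gt0.
have [d1 d10 H1] := near_norm (open_nbhs_nbhs (conj oU Uz)).
have H i : exists2 d : R, 0 < d & forall k : V, `|k| < d ->
    `|partial i f (k + z) - partial i f z| <= e'.
  have /cvgrPdist_le/(_ _ e'0)/near_norm[d d0 Hd] := cf i.
  by exists d => // k /Hd; rewrite distrC.
have [d d0 Hd] : exists2 d : R, 0 < d & forall k : V, `|k| < d ->
    U (k + z) /\ forall i, `|partial i f (k + z) - partial i f z| <= e'.
  pose d2 i := sval (cid2 (H i)).
  have d2P i : 0 < d2 i /\ forall k : V, `|k| < d2 i ->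
    `|partial i f (k + z) - partial i f z| <= e'.
    by rewrite /d2; case: (cid2 (H i)).
  exists (\big[Num.min/d1]_i d2 i).
    by apply/bigmin_gtP; split => // i _; case: (d2P i).
  move=> k /bigmin_gtP[/H1 ? kd]; split=> // i.
  by apply: (proj2 (d2P i)); exact: kd.
apply: (norm_near d0) => h; rewrite addr0 => hd.
(* Truncating [h] cannot increase its sup norm, so the whole path stays in the ball where the
   partial derivatives are controlled. *)
pose hk (k : nat) : V := \row_j (if (j < k)%N then h 0 j else 0).
have hk0 : hk 0%N = 0 by apply/rowP => j; rewrite !mxE.
have hkn : hk (n + n)%N = h by apply/rowP => j; rewrite !mxE ltn_ord.
have step (i : I) : hk i.+1 = hk i + h 0 i *: ebasis R i.
  apply/rowP => j; rewrite !mxE eqxx/= ltnS leq_eqVlt.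
  have [->|ji] := eqVneq j i; first by rewrite eqxx ltnn add0r mulr1.
  by rewrite (inj_eq val_inj) (negbTE ji)/= mulr0 addr0.
have hkd (i : I) t : 0 <= t <= 1 -> `|hk i + (t * h 0 i) *: ebasis R i| < d.
  move=> /andP[t0 t1]; apply: le_lt_trans hd; apply: rV_norm_le => // j.
  rewrite !mxE eqxx/=; have [->|ji] := eqVneq j i.
    rewrite ltnn add0r mulr1 normrM (ger0_norm t0).
    by rewrite (le_trans _ (rV_coord_norm h i))// ler_piMl.
  rewrite mulr0 addr0; case: ifP => _; first exact: rV_coord_norm.
  by rewrite normr0.
have -> : f (h + z) - f z =
    \sum_(i < n + n) (f (hk i.+1 + z) - f (hk i + z)).
  rewrite -(big_mkord xpredT (fun k => f (hk k.+1 + z) - f (hk k + z))).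
  rewrite (@telescope_sumr_eq _ 0 (n + n) (fun k => f (hk k + z)))//.
  by rewrite hkn hk0 add0r.
rewrite /= /L -sumrB.
apply: le_trans (ler_norm_sum _ _ _) _.
apply: (@le_trans _ _ (\sum_(i < n + n) e' * `|h|)).
  apply: ler_sum => i _; rewrite step.
  have [t /andP[/ltW t0 /ltW t1]] : exists2 t, 0 < t < 1 &
      f (hk i + z + h 0 i *: ebasis R i) - f (hk i + z) =
      h 0 i * partial i f (hk i + z + (t * h 0 i) *: ebasis R i).
    apply: mvt_slice => t t01; rewrite addrAC; apply: df.
    by apply: (proj1 (Hd _ _)); exact: hkd.
  have t01 : 0 <= t <= 1 by rewrite t0.
  rewrite addrAC => ->; rewrite [partial i f z * _]mulrC -mulrBr normrM mulrC.
  apply: ler_pM => //; last exact: rV_coord_norm.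
  by rewrite addrAC; apply: (proj2 (Hd _ _)); exact: hkd.
rewrite sumr_const card_ord -mulr_natl mulrA ler_wpM2r//.
rewrite /e' mulrCA ger_pMr// ler_pdivrMr// mul1r.
by rewrite lerDl.
Qed.

Lemma partial_eq U f g i z : open U -> U z -> (forall y, U y -> f y = g y) ->
  partial i f z = partial i g z.
Proof.
move=> oU Uz fg; apply: near_eq_derive.
by apply: filterS (open_nbhs_nbhs (conj oU Uz)).
Qed.

Definition diff_on U f := forall z, U z -> differentiable f z.

(** Pointwise Fréchet differentiability of [f] and its partials: closed under the algebra of the
    graph quantities, and what [schwarz] and the second-order test consume. *)
Definition diff2_on U f := diff_on U f /\ forall i, diff_on U (partial i f).

Section OnOpen.
Variable U : set V.
Hypothesis oU : open U.

Lemma diff_on_eq f g : (forall y, U y -> f y = g y) -> diff_on U f ->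
  diff_on U g.
Proof.
move=> fg df z Uz; apply: differentiable_near_eq (df z Uz).
by apply: filterS (open_nbhs_nbhs (conj oU Uz)).
Qed.

Lemma diff2_on_mul f g : diff2_on U f -> diff2_on U g ->
  diff2_on U (fun y => f y * g y).
Proof.
move=> [df ddf] [dg ddg]; split=> [z Uz|i].
  by apply: differentiable_mul; [exact: df|exact: dg].
apply: (@diff_on_eq (fun y => f y * partial i g y + g y * partial i f y)).
  by move=> y Uy; rewrite /partial derive_mul//; [exact: df|exact: dg].
move=> z Uz; apply: differentiable_add; apply: differentiable_mul;
  by [exact: df|exact: dg|exact: ddf|exact: ddg].
Qed.

Lemma diff2_on_add f g : diff2_on U f -> diff2_on U g ->
  diff2_on U (fun y => f y + g y).
Proof.
move=> [df ddf] [dg ddg]; split=> [z Uz|i].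
  by apply: differentiable_add; [exact: df|exact: dg].
apply: (@diff_on_eq (fun y => partial i f y + partial i g y)).
  by move=> y Uy; rewrite /partial derive_add//; [exact: df|exact: dg].
by move=> z Uz; apply: differentiable_add; [exact: ddf|exact: ddg].
Qed.

Lemma diff2_on_const (c : R) : diff2_on U (fun _ => c).
Proof.
split=> [z _|i]; first exact: differentiable_cst.
apply: (@diff_on_eq (fun _ => 0)); last by move=> z _; exact: differentiable_cst.
by move=> y _; rewrite /partial derive_const.
Qed.

Lemma diff2_on_sum m (F : 'I_m -> V -> R) : (forall k, diff2_on U (F k)) ->
  diff2_on U (fun y => \sum_k F k y).
Proof.
move=> dF; split=> [z Uz|i].
  by apply: differentiable_big => k; exact: (dF k).1.
apply: (@diff_on_eq (fun y => \sum_k partial i (F k) y)).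
  by move=> y Uy; rewrite /partial derive_big// => k; exact: (dF k).1.
by move=> z Uz; apply: differentiable_big => k; exact: (dF k).2.
Qed.

Lemma diff2_on_comp (phi psi : R -> R) f :
  (forall y, U y -> is_derive (f y) 1 phi (psi (f y))) ->
  diff_on U (fun y => psi (f y)) -> diff2_on U f ->
  diff2_on U (fun y => phi (f y)).
Proof.
move=> dphi dpsi [df ddf]; split=> [z Uz|i].
  by apply: differentiable_comp1; [have [] := dphi z Uz|exact: df].
apply: (@diff_on_eq (fun y => psi (f y) * partial i f y)).
  by move=> y Uy; rewrite /partial (derive_comp1 _ (dphi y Uy))//; exact: df.
by move=> z Uz; apply: differentiable_mul; [exact: dpsi|exact: ddf].
Qed.

Lemma partial_schwarz f i j z : U z -> diff2_on U f ->
  partial i (partial j f) z = partial j (partial i f) z.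
Proof.
move=> Uz [df ddf]; have Un := open_nbhs_nbhs (conj oU Uz).
apply: schwarz; try exact: ddf;
  by apply: filterS Un => y Uy; exact/diff_derivable/df.
Qed.

Lemma partial_at_max f i z : U z -> diff2_on U f ->
  (forall y, U y -> f y <= f z) -> partial i f z = 0.
Proof.
move=> Uz [df _] fz; have Un := open_nbhs_nbhs (conj oU Uz).
by apply: derive_at_local_max; apply: filterS Un.
Qed.

Lemma hessian_at_max f z v : U z -> diff2_on U f ->
  (forall y, U y -> f y <= f z) ->
  \sum_j v 0 j * \sum_i v 0 i * partial j (partial i f) z <= 0.
Proof.
move=> Uz [df ddf] fz; have Un := open_nbhs_nbhs (conj oU Uz).
have dvE y : U y -> \sum_i v 0 i * partial i f y = 'D_v f y.
  by move=> Uy; rewrite derive_direction//; exact: df.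
have ds i : differentiable (fun y => v 0 i * partial i f y) z.
  exact: (differentiable_mul (differentiable_cst _ _) (ddf i z Uz)).
have dv : diff_on U ('D_v f).
  apply: diff_on_eq dvE _ => y Uy; apply: differentiable_big => i.
  exact: (differentiable_mul (differentiable_cst _ _) (ddf i y Uy)).
have -> : \sum_j v 0 j * (\sum_i v 0 i * partial j (partial i f) z) =
    'D_v ('D_v f) z.
  rewrite derive_direction; last exact: dv.
  apply: eq_bigr => j _; congr (_ * _).
  rewrite -(@partial_eq U _ _ j z oU Uz dvE) (partial_big _ ds).
  by apply: eq_bigr => i _; rewrite (partial_mull _ _ (ddf i z Uz)).
apply: derive2_at_local_max (dv z Uz); first exact: filterS Un.
by apply: filterS Un.
Qed.

Lemma diff2_on_inv f : diff2_on U f -> (forall y, U y -> f y != 0) ->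
  diff2_on U (fun y => (f y)^-1).
Proof.
move=> [df ddf] f0; split=> [z Uz|i].
  by apply: differentiableV; [exact: df|exact: f0].
apply: (@diff_on_eq (fun y => - (f y)^-1 * (f y)^-1 * partial i f y)).
  move=> y Uy; rewrite [RHS]deriveV; [|exact: f0|exact/diff_derivable/df].
  by rewrite -[RHS]/(- f y ^- 2 * partial i f y) expr2 invfM mulNr.
move=> z Uz; have dV := differentiableV (df z Uz) (f0 z Uz).
exact: (differentiable_mul (differentiable_mul (differentiable_opp dV) dV)
  (ddf i z Uz)).
Qed.

End OnOpen.

Lemma partial_inv f i z : differentiable f z -> f z != 0 ->
  partial i (fun y => (f y)^-1) z = - (f z) ^- 2 * partial i f z.
Proof. by move=> df f0; apply: deriveV => //; exact: diff_derivable. Qed.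

End Coordinates.

(** * Linear algebra of the induced metric *)

Section CurvatureTerm.
Variables (R : realType) (d : nat).
Implicit Types (N b : 'rV[R]_d) (A B D P : 'M[R]_d).

Lemma mxtrace_mulmx_tr_ge0 m (T : 'M[R]_(m, d)) : 0 <= \tr (T *m T^T).
Proof.
rewrite /mxtrace sumr_ge0// => i _; rewrite mxE sumr_ge0// => j _.
by rewrite mxE -expr2 sqr_ge0.
Qed.

Lemma mxtrace_sym_skew D B : D^T = D -> B^T = - B -> \tr (D *m B) = 0.
Proof.
move=> Ds Bs; have : \tr (D *m B) = - \tr (D *m B).
  by rewrite -{1}mxtrace_tr trmx_mul Ds Bs mulNmx linearN/= mxtrace_mulC.
lra.
Qed.

Let trB m (X Y : 'M[R]_m) : \tr (X - Y) = \tr X - \tr Y.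
Proof. exact: linearB. Qed.

Let trN m (X : 'M[R]_m) : \tr (- X) = - \tr X.
Proof. exact: linearN. Qed.

(** [1%:M - N^T *m N] is the inverse of the metric 1 + q^T q. It is the identity orthogonally to [N]
    and has eigenvalue [nu ^+ 2] along [N]. Its root must have eigenvalue [nu] there, so the
    coefficient [c] solves c (1 - nu^2) = 1 - nu. *)
Lemma metric_sqrt N (nu : R) : 0 < nu -> N *m N^T = (1 - nu ^+ 2)%:M ->
  exists h : 'M[R]_d, [/\ h^T = h, h *m h = 1%:M - N^T *m N, N *m h = nu *: N
    & forall b, N *m b^T = 0 -> b *m h = b].
Proof.
move=> nu0 NN; have nu1 : 1 + nu != 0 by rewrite gt_eqF// addr_gt0.
pose c := (1 + nu)^-1; pose h := 1%:M - c *: (N^T *m N).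
have Nh : N *m h = nu *: N.
  rewrite mulmxBr mulmx1 -scalemxAr mulmxA NN mul_scalar_mx scalerA.
  rewrite -{1}[N]scale1r -scalerBl; congr (_ *: _).
  by rewrite /c; field.
exists h; split=> // [||b Nb].
- by rewrite linearB/= trmx1 linearZ/= trmx_mul trmxK.
- rewrite {1}/h mulmxBl mul1mx -scalemxAl -mulmxA Nh -scalemxAr scalerA.
  rewrite {1}/h -addrA -opprD -scalerDl.
  have -> : c + c * nu = 1 by rewrite /c; field.
  by rewrite scale1r.
- have bN : b *m N^T = 0 by rewrite -[LHS]trmxK trmx_mul trmxK Nb trmx0.
  by rewrite mulmxBr mulmx1 -scalemxAr mulmxA bN mul0mx scaler0 subr0.
Qed.

(* With [h] the square root of [G] and [S = h D h], this is the positivity of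
   the squared norm of [S - (2 / nu) N^T b]. *)
Lemma metric_square_ge N b D G (nu : R) :
  G = 1%:M - N^T *m N -> 0 < nu ->
  N *m N^T = (1 - nu ^+ 2)%:M -> N *m b^T = 0 -> D^T = D ->
  4 * \tr (N *m D *m b^T) - 4 * nu ^- 2 * (1 - nu ^+ 2) * \tr (b *m b^T)
    <= \tr (G *m D *m G *m D).
Proof.
move=> GE nu0 NN Nb Ds.
have [h [hT hh Nh /(_ b Nb) bh]] := metric_sqrt nu0 NN.
have : exists S, S = h *m D *m h by eexists.
move=> [S SE]; have ST : S^T = S by rewrite SE !trmx_mul hT Ds mulmxA.
have := mxtrace_mulmx_tr_ge0 (S - (2 / nu) *: (N^T *m b)).
have -> : (S - (2 / nu) *: (N^T *m b))^T = S - (2 / nu) *: (b^T *m N).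
  have E : ((2 / nu) *: (N^T *m b))^T = (2 / nu) *: (b^T *m N).
    by rewrite linearZ/= trmx_mul trmxK.
  by rewrite linearB/= ST E.
rewrite mulmxBl !mulmxBr !trB -!scalemxAl -!scalemxAr !mxtraceZ.
have hb : h *m b^T = b^T by rewrite -{1}hT -trmx_mul bh.
have hN : h *m N^T = nu *: N^T by rewrite -{1}hT -trmx_mul Nh linearZ.
have E1 : \tr (S *m (b^T *m N)) = nu * \tr (N *m D *m b^T).
  rewrite SE mulmxA mxtrace_mulC !mulmxA Nh -!mulmxA hb !mulmxA.
  by rewrite -!scalemxAl mxtraceZ.
have E2 : \tr (N^T *m b *m S) = nu * \tr (N *m D *m b^T).
  by rewrite -E1 -mxtrace_tr !trmx_mul ST trmxK.
have E3 : \tr (N^T *m b *m (b^T *m N)) = (1 - nu ^+ 2) * \tr (b *m b^T).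
  rewrite mulmxA mxtrace_mulC !mulmxA NN -!mulmxA mul_scalar_mx mxtraceZ.
  by [].
have E4 : \tr (S *m S) = \tr (G *m D *m G *m D).
  rewrite SE GE -hh !mulmxA mxtrace_mulC !mulmxA.
  by [].
rewrite E1 E2 E3 E4 => H.
rewrite -subr_ge0; apply: le_trans H _; rewrite le_eqVlt; apply/orP; left.
by apply/eqP; field; rewrite gt_eqF.
Qed.

(** Write b = N B, which is orthogonal to [N] because [B] is skew. Traces of symmetric against skew
    matrices vanish, and the right-hand side becomes nu^2 (tr (G D G D) - 4 tr (N D b^T) - tr (B B)
    - 2 |b|^2). [metric_square_ge] absorbs the term linear in [D] at the cost 4 (1 - nu^2) |b|^2,
    and - tr (B B) >= 0. *)
Lemma curvature_term_ge N D B P A (nu : R) :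
  0 < nu -> N *m N^T = (1 - nu ^+ 2)%:M -> D^T = D -> B^T = - B ->
  P = D + B -> A = nu *: ((1%:M - N^T *m N) *m P) ->
  - 4 * \tr (N *m B *m (N *m B)^T) <=
  \tr (A *m A) - 2 * nu ^+ 2 * \tr (N *m P *m (N *m B)^T)
    + 2 * nu * \tr (A^T *m B).
Proof.
move=> nu0 NN Ds Bs -> ->.
have : exists G, 1%:M - N^T *m N = G by eexists.
move=> [G GE]; rewrite GE.
have bT : (N *m B)^T = - (B *m N^T) by rewrite trmx_mul Bs mulNmx.
have : exists b, N *m B = b by exists (N *m B).
move=> [b NB]; rewrite NB in bT *.
have BN : B *m N^T = - b^T by rewrite bT opprK.
have Nb : N *m b^T = 0.
  have E : (N *m b^T)^T = - (N *m b^T).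
    by rewrite trmx_mul trmxK bT mulmxN opprK mulmxA NB.
  apply/matrixP => i j; rewrite !ord1 [RHS]mxE.
  move/matrixP: E => /(_ 0 0); rewrite [LHS]mxE [RHS]mxE.
  by move: ((N *m b^T) 0 0) => x; lra.
have bN : b *m N^T = 0 by rewrite -[LHS]trmxK trmx_mul trmxK Nb trmx0.
have := metric_square_ge (esym GE) nu0 NN Nb Ds.
have GT : G^T = G by rewrite -GE linearB/= trmx1 trmx_mul trmxK.
have GB : G *m B = B - N^T *m b by rewrite -GE mulmxBl mul1mx -mulmxA NB.
have tB : \tr (B *m N^T *m b) = - \tr (b *m b^T).
  by rewrite BN mulNmx trN mxtrace_mulC.
have tB' : \tr (N^T *m b *m B) = - \tr (b *m b^T).
  by rewrite -mulmxA mxtrace_mulC -mulmxA BN mulmxN trN.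
have T1 : \tr (G *m B *m G *m B) = \tr (B *m B) + 2 * \tr (b *m b^T).
  rewrite -[_ *m G *m B]mulmxA GB mulmxBl !mulmxBr !trB.
  rewrite !mulmxA tB tB' -[N^T *m b *m _]mulmxA bN mulmx0 mul0mx mxtrace0.
  by ring.
have T2 : \tr (G *m D *m G *m B) = 0.
  by apply: mxtrace_sym_skew => //; rewrite !trmx_mul GT Ds mulmxA.
have T3 : \tr (G *m B *m G *m D) = 0.
  by rewrite -mulmxA mxtrace_mulC mulmxA T2.
have T4 : \tr (G *m D *m B) = \tr (N *m D *m b^T).
  rewrite -GE mulmxBl mul1mx mulmxBl trB mxtrace_sym_skew// sub0r.
  rewrite -!mulmxA mxtrace_mulC -!mulmxA BN !mulmxN trN opprK.
  by [].
have T5 : \tr (G *m B *m B) = \tr (B *m B) + \tr (b *m b^T).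
  by rewrite GB mulmxBl trB tB' opprK.
have BB : \tr (B *m B) <= 0.
  have := mxtrace_mulmx_tr_ge0 B; rewrite Bs mulmxN trN; lra.
have bb := mxtrace_mulmx_tr_ge0 b.
have -> : \tr ((nu *: (G *m (D + B))) *m (nu *: (G *m (D + B)))) =
   nu ^+ 2 * (\tr (G *m D *m G *m D) + \tr (B *m B) + 2 * \tr (b *m b^T)).
  rewrite -scalemxAl -scalemxAr scalerA -expr2 mxtraceZ; congr (_ * _).
  rewrite mulmxA !mulmxDr !mulmxDl !mxtraceD T1 T2 T3.
  by ring.
have -> : \tr (N *m (D + B) *m b^T) = \tr (N *m D *m b^T) + \tr (b *m b^T).
  by rewrite mulmxDr mulmxDl mxtraceD NB.
have -> : \tr ((nu *: (G *m (D + B)))^T *m B) =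
   - nu * (\tr (N *m D *m b^T) + \tr (B *m B) + \tr (b *m b^T)).
  rewrite -mxtrace_tr trmx_mul trmxK Bs mulNmx trN mxtrace_mulC.
  rewrite -scalemxAl mxtraceZ mulmxDr mulmxDl mxtraceD T4 T5.
  by ring.
move: (\tr (N *m D *m b^T)) (\tr (G *m D *m G *m D)) (\tr (B *m B)) bb BB.
move: (\tr (b *m b^T)) => be de gd bb be0 BB H.
have n2 : 0 < nu ^+ 2 by rewrite exprn_gt0.
have {}H : nu ^+ 2 * (4 * de) - 4 * (1 - nu ^+ 2) * be <= nu ^+ 2 * gd.
  have := ler_wpM2l (ltW n2) H; apply: le_trans; rewrite le_eqVlt.
  by apply/orP; left; apply/eqP; field; rewrite gt_eqF.
have n2b : 0 <= nu ^+ 2 * be by rewrite mulr_ge0// ltW.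
have n2B : nu ^+ 2 * bb <= 0 by rewrite pmulr_rle0.
nra.
Qed.

End CurvatureTerm.

(** * The maximum principle on a graph *)

(** [e] stands for exp (K phi) at the maximum, [S] and [L] for the weighted squared gradient and
    Laplacian of phi, [Lnu] for the weighted Laplacian of nu. As (e - 1) C0 <= e C0, the factor [e]
    cancels and the conclusion does not depend on its size. *)
Lemma barrier_max_arith (R : realType)
    (e nu alpha K C0 C1 C2 Nb S L Lnu : R) :
  1 <= e -> 0 < nu -> 0 <= alpha -> 0 <= K -> 0 <= C0 -> - C2 <= Nb ->
  alpha ^+ 2 * (1 - nu ^+ 2) + 2 * alpha * nu * Nb <= nu * S ->
  - C1 <= nu * L -> Lnu <= C0 ->
  e * (K * (K * S + L)) <= (e - 1) * nu^-1 * Lnu ->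
  K ^+ 2 * (alpha ^+ 2 * (1 - nu ^+ 2) - 2 * alpha * nu * C2) <= K * C1 + C0.
Proof.
move=> e1 nu0 al0 K0 C00 hC2 G hC1 hLnu M.
have e0 : 0 < e by apply: lt_le_trans e1.
have {}M : e * (K * (K * (nu * S) + nu * L)) <= (e - 1) * Lnu.
  have := ler_wpM2l (ltW nu0) M.
  have -> : nu * ((e - 1) / nu * Lnu) = (e - 1) * Lnu.
    by field; rewrite gt_eqF.
  by apply: le_trans; rewrite le_eqVlt; apply/orP; left; apply/eqP; ring.
have M1 : (e - 1) * Lnu <= e * C0.
  have h1 : (e - 1) * Lnu <= (e - 1) * C0 by rewrite ler_wpM2l// subr_ge0.
  by apply: le_trans h1 _; rewrite ler_wpM2r// gerBl.
have := le_trans M M1; rewrite ler_pM2l// => M2.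
have G2 : alpha ^+ 2 * (1 - nu ^+ 2) - 2 * alpha * nu * C2 <= nu * S.
  have an : 0 <= 2 * alpha * nu by rewrite !mulr_ge0// ltW.
  have := ler_wpM2l an hC2; lra.
have h1 := ler_wpM2l (mulr_ge0 K0 K0) G2.
have h2 := ler_wpM2l K0 hC1.
by rewrite expr2; lra.
Qed.

(* The graph with rescaled horizontal gradient [q], vertical normal component
   [nu], horizontal normal [N] and mean curvature [H]; [2 B] is the curl of the
   connection form. *)
Record graph_on (R : realType) (n : nat) (U : set 'rV[R]_(n + n))
    (q : 'I_(n + n) -> 'rV[R]_(n + n) -> R) (nu H : 'rV[R]_(n + n) -> R)
    (B : 'M[R]_(n + n)) (N : 'I_(n + n) -> 'rV[R]_(n + n) -> R) : Prop := {
  graph_open : open U;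
  graph_q_diff2 : forall i, diff2_on U (q i);
  graph_nu_diff2 : diff2_on U nu;
  graph_nu_gt0 : forall y, U y -> 0 < nu y;
  graph_nu_q : forall y, U y -> nu y * nu y * (1 + \sum_i q i y * q i y) = 1;
  graph_B_skew : forall i j, B i j = - B j i;
  graph_curl_q : forall i j y, U y ->
    partial j (q i) y = partial i (q j) y + 2 * B i j;
  graph_N : forall i y, N i y = nu y * q i y;
  graph_divergence_N : forall y, U y -> \sum_i partial i (N i) y = H y
}.

Lemma graph_on_sub (R : realType) (n : nat) (U U' : set 'rV[R]_(n + n)) q nu H B
    N : open U' -> U' `<=` U -> graph_on U q nu H B N -> graph_on U' q nu H B N.
Proof.
move=> oU' sU [oU dq [dn ddn] n0 nq Bs cq NE dN]; split=> //.
- by move=> i; split=> [y /sU /(dq i).1 //|j y /sU]; exact: (dq i).2.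
- by split=> [y /sU /dn|j y /sU /(ddn j)].
- by move=> y /sU /n0.
- by move=> y /sU /nq.
- by move=> i j y /sU /cq.
- by move=> y /sU /dN.
Qed.

(** * The Jacobi equation and the second-order operator of the graph *)

Section Operator.
Variables (R : realType) (n : nat).
Notation V := 'rV[R]_(n + n).
Notation I := 'I_(n + n).
Variables (U : set V) (q : I -> V -> R) (nu H : V -> R) (B : 'M[R]_(n + n)).
Variable N : I -> V -> R.
Hypothesis graph : graph_on U q nu H B N.

Let oU := graph_open graph.
Let q_diff2 := graph_q_diff2 graph.
Let nu_diff2 := graph_nu_diff2 graph.
Let nu_gt0 := graph_nu_gt0 graph.
Let nu_q := graph_nu_q graph.
Let B_skew := graph_B_skew graph.
Let curl_q := graph_curl_q graph.
Let N_def := graph_N graph.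
Let divergence_N := graph_divergence_N graph.

Let N_diff2 i : diff2_on U (N i).
Proof.
have -> : N i = (fun y => nu y * q i y) by apply/funext => y; exact: N_def.
exact: diff2_on_mul.
Qed.

Let nu_diff y : U y -> differentiable nu y.
Proof. exact: nu_diff2.1. Qed.

Let q_diff i y : U y -> differentiable (q i) y.
Proof. exact: (q_diff2 i).1. Qed.

Let N_diff i y : U y -> differentiable (N i) y.
Proof. exact: (N_diff2 i).1. Qed.

Lemma partial_nu j y : U y ->
  partial j nu y = - nu y ^+ 2 * \sum_i N i y * partial j (q i) y.
Proof.
move=> Uy; have nu0 := nu_gt0 Uy.
have := @partial_eq _ _ U (fun y => nu y * nu y * (1 + \sum_i q i y * q i y))
  (fun _ => 1) j y oU Uy nu_q.
have dn := nu_diff Uy.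
have dq2 i : differentiable (fun y => q i y * q i y) y.
  exact: (differentiable_mul (q_diff i Uy) (q_diff i Uy)).
have dsum := differentiable_big dq2.
have dn2 := differentiable_mul dn dn.
have d1 : differentiable (fun _ : V => 1 : R) y by exact: differentiable_cst.
rewrite partial_const (partial_mul _ dn2 (differentiable_add d1 dsum)).
rewrite (partial_add _ d1 dsum) partial_const add0r (partial_big _ dq2).
rewrite (partial_mul _ dn dn).
have -> : \sum_i partial j (fun y => q i y * q i y) y =
    2 * \sum_i q i y * partial j (q i) y.
  rewrite mulr_sumr; apply: eq_bigr => i _.
  by rewrite (partial_mul _ (q_diff i Uy) (q_diff i Uy)); ring.
have -> : \sum_i N i y * partial j (q i) y = nu y * \sum_i q i y * partial j (q i) y.
  by rewrite mulr_sumr; apply: eq_bigr => i _; rewrite N_def mulrA.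
have := nu_q Uy.
move: (1 + _) (\sum_i _ * partial j _ _) (partial j nu y) => s Q x E1 E2.
(* The relation nu^2 (1 + |q|^2) = 1 has been differentiated implicitly; one more factor [nu y] lets
   the same relation eliminate 1 + |q|^2. *)
have E3 : nu y * (nu y * nu y * (2 * Q) + s * (nu y * x + nu y * x)) = 0.
  by rewrite E2 mulr0.
have : 2 * (x * (nu y * nu y * s)) = - 2 * (nu y ^+ 3 * Q).
  by move: E3; lra.
by rewrite E1; lra.
Qed.

Lemma partial_N i j y : U y -> partial j (N i) y =
  nu y * (partial j (q i) y - N i y * \sum_l N l y * partial j (q l) y).
Proof.
move=> Uy.
rewrite (@partial_eq _ _ U _ _ j y oU Uy (fun y _ => N_def i y)).
rewrite (partial_mul _ (nu_diff Uy) (q_diff i Uy)) partial_nu// N_def.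
by ring.
Qed.

Lemma sum_N_sq y : U y -> \sum_i N i y * N i y = 1 - nu y ^+ 2.
Proof.
move=> Uy; have := nu_q Uy.
have -> : \sum_i N i y * N i y = nu y * nu y * \sum_i q i y * q i y.
  by rewrite mulr_sumr; apply: eq_bigr => i _; rewrite N_def; ring.
by lra.
Qed.

(* The area-weighted gradient [nu^-1 g^{kj} f_j] of [f] for the metric
   [g_ij = delta_ij + q_i q_j] induced on the graph. *)
Definition weighted_grad (f : V -> R) k y :=
  (nu y)^-1 * (partial k f y - N k y * \sum_j N j y * partial j f y).

(** The curl relation trades the derivative of [q l] in direction [k] for that of [q k] in direction
    [l]. In this form the divergence contains derivatives of the divergence of [N], that is of
    [H]. *)
Lemma weighted_grad_nu k y : U y -> weighted_grad nu k y =
  - ((\sum_l partial l (N k) y * N l y) + 2 * nu y * \sum_l N l y * B l k).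
Proof.
move=> Uy; have nu0 := nu_gt0 Uy; rewrite /weighted_grad partial_nu//.
pose m j := \sum_i N i y * partial j (q i) y.
have -> : \sum_j N j y * partial j nu y = - nu y ^+ 2 * \sum_j N j y * m j.
  by rewrite mulr_sumr; apply: eq_bigr => j _; rewrite partial_nu// mulrCA.
rewrite -/(m k).
have -> : \sum_l partial l (N k) y * N l y =
    nu y * (m k - 2 * (\sum_l N l y * B l k) - N k y * \sum_j N j y * m j).
  rewrite mulrBr mulrBr {1}/m !mulr_sumr -!sumrB; apply: eq_bigr => l _.
  by rewrite partial_N// (curl_q k l Uy) (B_skew k l) /m; ring.
by field; rewrite gt_eqF.
Qed.

(** The Jacobi equation as an exact identity. Exchanging the derivatives in the second-order term of
    [N k] and summing over [k] gives the derivative of [H]; the double sum is the trace of the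
    square of [A]. *)
Lemma divergence_weighted_grad_nu y : U y ->
  \sum_k partial k (weighted_grad nu k) y =
  - ((\sum_l N l y * partial l H y)
     + (\sum_k \sum_l partial l (N k) y * partial k (N l) y)
     + \sum_k (2 * partial k nu y * (\sum_l N l y * B l k)
               + 2 * nu y * \sum_l partial k (N l) y * B l k)).
Proof.
move=> Uy.
have dN l := N_diff l Uy.
have dNN k l : differentiable (partial l (N k)) y by exact: (N_diff2 k).2.
have dNl k l : differentiable (fun y => partial l (N k) y * N l y) y.
  exact: (differentiable_mul (dNN k l) (dN l)).
have dNB k l : differentiable (fun y => N l y * B l k) y.
  exact: (differentiable_mul (dN l) (differentiable_cst _ _)).
have dn := nu_diff Uy.
have dn2 : differentiable (fun y => 2 * nu y) y.
  exact: (differentiable_mul (differentiable_cst _ _) dn).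
have -> : \sum_k partial k (weighted_grad nu k) y = \sum_k
   - ((\sum_l (partial l (N k) y * partial k (N l) y +
               N l y * partial l (partial k (N k)) y)) +
     (2 * partial k nu y * (\sum_l N l y * B l k)
               + 2 * nu y * \sum_l partial k (N l) y * B l k)).
  apply: eq_bigr => k _.
  rewrite (@partial_eq _ _ U _ _ k y oU Uy (weighted_grad_nu k)).
  have d1 := differentiable_big (dNl k); have d2 := differentiable_big (dNB k).
  have d3 := differentiable_mul dn2 d2.
  rewrite (partial_opp _ (differentiable_add d1 d3)) (partial_add _ d1 d3).
  rewrite (partial_mul _ dn2 d2) (partial_big _ (dNl k)) (partial_big _ (dNB k)).
  rewrite (partial_mull _ _ dn); congr (- (_ + _)).
    apply: eq_bigr => l _; rewrite (partial_mul _ (dNN k l) (dN l)).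
    by rewrite (@partial_schwarz _ _ U oU (N k) k l).
  rewrite addrC; congr (_ + _); first by rewrite mulrC.
  congr (_ * _); apply: eq_bigr => l _.
  by rewrite (partial_mulr _ _ (dN l)).
rewrite sumrN big_split/=; congr (- (_ + _)).
have -> : \sum_l N l y * partial l H y =
    \sum_l \sum_k N l y * partial l (partial k (N k)) y.
  apply: eq_bigr => l _; rewrite -mulr_sumr; congr (_ * _).
  rewrite -(@partial_eq _ _ U _ _ l y oU Uy divergence_N).
  by rewrite (partial_big _ (fun k => (N_diff2 k).2 k y Uy)).
rewrite [X in _ = X + _]exchange_big/= -big_split/=; apply: eq_bigr => k _.
by rewrite big_split/= addrC.
Qed.

Lemma divergence_weighted_grad_nu_le y : U y ->
  \sum_k partial k (weighted_grad nu k) y <=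
  - (\sum_l N l y * partial l H y) + 4 * \sum_k (\sum_l N l y * B l k) ^+ 2.
Proof.
move=> Uy; rewrite divergence_weighted_grad_nu//.
pose Nm : 'rV[R]_(n + n) := \row_i N i y.
pose Pm := \matrix_(i, j) partial j (q i) y.
pose Am := \matrix_(i, j) partial j (N i) y.
(* By the curl relation [B] is exactly the skew part of [Pm], so [Dm] is the symmetric part. *)
pose Dm := Pm - B.
have NE j (M : 'M[R]_(n + n)) : (Nm *m M) 0 j = \sum_l N l y * M l j.
  by rewrite mxE; apply: eq_bigr => l _; rewrite mxE.
have trE (v w : 'rV[R]_(n + n)) : \tr (v *m w^T) = \sum_k v 0 k * w 0 k.
  by rewrite /mxtrace big_ord1 mxE; apply: eq_bigr => k _; rewrite mxE.
have NN : Nm *m Nm^T = (1 - nu y ^+ 2)%:M.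
  apply/matrixP => i j; rewrite !ord1 [LHS]mxE [RHS]mxE eqxx mulr1n -sum_N_sq//.
  by apply: eq_bigr => k _; rewrite !mxE.
have Bs : B^T = - B by apply/matrixP => i j; rewrite !mxE B_skew.
have Ds : Dm^T = Dm.
  apply/matrixP => i j; rewrite !mxE (curl_q j i Uy) (B_skew i j); ring.
have PE : Pm = Dm + B by rewrite subrK.
have AE : Am = nu y *: ((1%:M - Nm^T *m Nm) *m Pm).
  apply/matrixP => i j; rewrite mxE partial_N// [RHS]mxE; congr (_ * _).
  have -> : (1%:M - Nm^T *m Nm) *m Pm = Pm - Nm^T *m (Nm *m Pm).
    by rewrite mulmxBl mul1mx -mulmxA.
  have -> : (Pm - Nm^T *m (Nm *m Pm)) i j = Pm i j - Nm 0 i * (Nm *m Pm) 0 j.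
    rewrite [LHS]mxE; congr (_ + _); rewrite [LHS]mxE; congr (- _).
    by rewrite [LHS]mxE big_ord1 [X in X * _]mxE.
  rewrite NE [Pm i j]mxE [Nm 0 i]mxE; congr (_ - _ * _).
  by apply: eq_bigr => l _; rewrite mxE.
have := curvature_term_ge (nu_gt0 Uy) NN Ds Bs PE AE.
have -> : \tr (Am *m Am) =
    \sum_k \sum_l partial l (N k) y * partial k (N l) y.
  by apply: eq_bigr => k _; rewrite mxE; apply: eq_bigr => l _; rewrite !mxE.
have -> : \tr (Am^T *m B) = \sum_k \sum_l partial k (N l) y * B l k.
  by apply: eq_bigr => k _; rewrite mxE; apply: eq_bigr => l _; rewrite !mxE.
rewrite !trE.
have -> : \sum_k (Nm *m B) 0 k * (Nm *m B) 0 k =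
    \sum_k (\sum_l N l y * B l k) ^+ 2.
  by apply: eq_bigr => k _; rewrite NE.
have -> : \sum_k (2 * partial k nu y * (\sum_l N l y * B l k)
               + 2 * nu y * \sum_l partial k (N l) y * B l k) =
  - 2 * nu y ^+ 2 * (\sum_k (Nm *m Pm) 0 k * (Nm *m B) 0 k)
  + 2 * nu y * \sum_k \sum_l partial k (N l) y * B l k.
  rewrite !mulr_sumr -big_split/=; apply: eq_bigr => k _; congr (_ + _).
  rewrite !NE partial_nu//.
  have -> : \sum_l N l y * Pm l k = \sum_i N i y * partial k (q i) y.
    by apply: eq_bigr => l _; rewrite mxE.
  by ring.
lra.
Qed.

Lemma weighted_grad_diff f k : diff2_on U f -> diff_on U (weighted_grad f k).
Proof.
move=> [_ df] y Uy.
have nV := differentiableV (nu_diff Uy) (lt0r_neq0 (nu_gt0 Uy)).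
have ds : differentiable (fun y => \sum_j N j y * partial j f y) y.
  by apply: differentiable_big => j;
    exact: (differentiable_mul (N_diff j Uy) (df j y Uy)).
exact: (differentiable_mul nV (differentiable_add (df k y Uy)
  (differentiable_opp (differentiable_mul (N_diff k Uy) ds)))).
Qed.

(** With [h] the symmetric root of the inverse metric, the expression is the trace of h F h, hence a
    sum of second derivatives of [f] along the rows of [h], each nonpositive at a maximum. *)
Lemma metric_hessian_at_max f z : U z -> diff2_on U f ->
  (forall y, U y -> f y <= f z) ->
  \sum_k (partial k (partial k f) z
          - N k z * \sum_j N j z * partial k (partial j f) z) <= 0.
Proof.
move=> Uz df fz.
pose Nm : 'rV[R]_(n + n) := \row_i N i z.
pose F := \matrix_(j, i) partial j (partial i f) z.
have NN : Nm *m Nm^T = (1 - nu z ^+ 2)%:M.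
  apply/matrixP => i j; rewrite !ord1 [LHS]mxE [RHS]mxE eqxx mulr1n -sum_N_sq//.
  by apply: eq_bigr => k _; rewrite !mxE.
have [h [hT hh _ _]] := metric_sqrt (nu_gt0 Uz) NN.
have -> : \sum_k (partial k (partial k f) z
          - N k z * \sum_j N j z * partial k (partial j f) z) =
    \tr (h *m F *m h).
  rewrite mxtrace_mulC mulmxA hh mulmxBl mul1mx linearB/= sumrB; congr (_ - _).
    by apply: eq_bigr => k _; rewrite mxE.
  rewrite -mulmxA mxtrace_mulC /mxtrace big_ord1 mxE.
  under eq_bigr do rewrite mulr_sumr.
  rewrite exchange_big/=; apply: eq_bigr => j _.
  rewrite [Nm^T _ _]mxE [Nm 0 j]mxE mxE mulr_suml; apply: eq_bigr => k _.
  by rewrite !mxE; ring.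
have E i j : (h *m F *m h) i j =
    \sum_l (\sum_k h i k * F k l) * h l j.
  by rewrite mxE; apply: eq_bigr => l _; rewrite mxE.
rewrite /mxtrace sumr_le0// => i _; rewrite E.
have := hessian_at_max oU (row i h) Uz df fz.
congr (_ <= 0); under eq_bigr do rewrite mulr_sumr.
rewrite exchange_big/=; apply: eq_bigr => l _.
rewrite mulr_suml; apply: eq_bigr => k _.
have -> : h l i = h i l by rewrite -{1}hT mxE.
by rewrite !mxE; ring.
Qed.

(** By the product rule the weighted gradient of E = f nu is [f] times that of [nu] plus g^-1 Df. At
    the maximum Df = 0, so the divergence of the last field reduces to the metric trace of the
    Hessian. *)
Lemma divergence_weighted_grad_at_max (E f : V -> R) z : U z ->
  diff2_on U f -> (forall y, U y -> E y = f y * nu y) ->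
  (forall y, U y -> f y <= f z) ->
  \sum_k partial k (weighted_grad E k) z <=
  f z * \sum_k partial k (weighted_grad nu k) z.
Proof.
move=> Uz df Ef fz; have f0 i := partial_at_max oU i Uz df fz.
have WE k y : U y -> weighted_grad E k y =
    f y * weighted_grad nu k y
    + (partial k f y - N k y * \sum_j N j y * partial j f y).
  move=> Uy; have nu0 := nu_gt0 Uy; rewrite /weighted_grad.
  have PE j : partial j E y = f y * partial j nu y + nu y * partial j f y.
    rewrite (@partial_eq _ _ U _ _ j y oU Uy Ef).
    by rewrite (partial_mul _ (df.1 y Uy) (nu_diff Uy)).
  have -> : \sum_j N j y * partial j E y =
      f y * (\sum_j N j y * partial j nu y)
      + nu y * \sum_j N j y * partial j f y.
    rewrite !mulr_sumr -big_split/=; apply: eq_bigr => j _.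
    by rewrite PE; ring.
  by rewrite PE; field; rewrite gt_eqF.
have Ek k : partial k (weighted_grad E k) z =
    f z * partial k (weighted_grad nu k) z
    + (partial k (partial k f) z
       - N k z * \sum_j N j z * partial k (partial j f) z).
  have dW := weighted_grad_diff k nu_diff2 Uz.
  have dfk := df.2 k z Uz.
  have dj j : differentiable (fun y => N j y * partial j f y) z.
    exact: (differentiable_mul (N_diff j Uz) (df.2 j z Uz)).
  have ds := differentiable_big dj.
  have dNs := differentiable_mul (N_diff k Uz) ds.
  rewrite (@partial_eq _ _ U _ _ k z oU Uz (WE k)).
  rewrite (partial_add _ (differentiable_mul (df.1 z Uz) dW)
    (differentiable_add dfk (differentiable_opp dNs))).
  rewrite (partial_mul _ (df.1 z Uz) dW) f0 mulr0 addr0; congr (_ + _).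
  rewrite (partial_add _ dfk (differentiable_opp dNs)) (partial_opp _ dNs).
  congr (_ - _); rewrite (partial_mul _ (N_diff k Uz) ds) (partial_big _ dj).
  rewrite [X in _ + X * _]big1 ?mul0r ?addr0; last by move=> j _; rewrite f0 mulr0.
  congr (_ * _); apply: eq_bigr => j _.
  by rewrite (partial_mul _ (N_diff j Uz) (df.2 j z Uz)) f0 mul0r addr0.
have SE : \sum_k partial k (weighted_grad E k) z =
    \sum_k (f z * partial k (weighted_grad nu k) z
    + (partial k (partial k f) z
       - N k z * \sum_j N j z * partial k (partial j f) z)).
  by apply: eq_bigr => k _; exact: Ek.
rewrite [leLHS]SE big_split/= mulr_sumr gerDl.
exact: metric_hessian_at_max.
Qed.

(** * Barriers whose gradient is a multiple of the slope plus a controlled field *)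

Section Barrier.
Variables (phi : V -> R) (alpha : R) (b : I -> V -> R).
Hypothesis phi_diff : diff_on U phi.
Hypothesis b_diff : forall i, diff_on U (b i).
Hypothesis grad_phi : forall i y, U y -> partial i phi y = alpha * q i y + b i y.

Let dots y : U y ->
  \sum_j N j y * partial j phi y =
  alpha * (nu y * \sum_j q j y * q j y) + nu y * \sum_j q j y * b j y.
Proof.
move=> Uy; rewrite !mulr_sumr -big_split/=; apply: eq_bigr => j _.
by rewrite grad_phi// N_def; ring.
Qed.

(** Since g^-1 q = nu^2 q, the slope part of the gradient becomes [alpha * N k], whose divergence is
    [alpha] times [H]. *)
Lemma weighted_grad_barrier k y : U y -> weighted_grad phi k y =
  alpha * N k y + (nu y)^-1 * b k y - N k y * \sum_j q j y * b j y.
Proof.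
move=> Uy; have nu0 := nu_gt0 Uy; rewrite /weighted_grad dots// grad_phi// N_def.
have := nu_q Uy; move: (\sum_j _) (\sum_j _) => qb qq nq.
have -> : alpha * q k y + b k y - nu y * q k y * (alpha * (nu y * qq) + nu y * qb)
  = alpha * q k y * (1 - nu y * nu y * qq) + b k y - nu y * nu y * q k y * qb.
  by ring.
have -> : 1 - nu y * nu y * qq = nu y * nu y by move: nq; lra.
by field; rewrite gt_eqF.
Qed.

(** The right-hand side is |D phi|^2 - (N . D phi)^2. Its part in [q] alone is alpha^2 (1 - nu^2)
    and its part in [b] alone, |b|^2 - (N . b)^2, is nonnegative because |N| <= 1; the cross term is
    kept. *)
Lemma barrier_gradient_ge z : U z ->
  alpha ^+ 2 * (1 - nu z ^+ 2) + 2 * alpha * nu z * (\sum_j N j z * b j z)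
  <= nu z * \sum_k partial k phi z * weighted_grad phi k z.
Proof.
move=> Uz; have nu0 := nu_gt0 Uz.
pose qq := \sum_j q j z * q j z; pose qb := \sum_j q j z * b j z.
pose bb := \sum_j b j z * b j z; pose Nb := \sum_j N j z * b j z.
have NbE : Nb = nu z * qb.
  by rewrite /Nb /qb mulr_sumr; apply: eq_bigr => j _; rewrite N_def mulrA.
have -> : nu z * (\sum_k partial k phi z * weighted_grad phi k z) =
    alpha ^+ 2 * qq + 2 * alpha * qb + bb - (nu z * (alpha * qq + qb)) ^+ 2.
  have := dots Uz; rewrite -/qq -/qb.
  have -> : alpha * (nu z * qq) + nu z * qb = nu z * (alpha * qq + qb) by ring.
  move: (nu z * (alpha * qq + qb)) => s sE; rewrite [s ^+ 2]expr2 -{2}sE.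
  rewrite /qq /qb /bb !mulr_sumr -!big_split/= -sumrB; apply: eq_bigr => k _.
  by rewrite /weighted_grad sE grad_phi//; field; rewrite gt_eqF.
have NbB : Nb ^+ 2 <= bb.
  have : 0 <= \sum_k (b k z - Nb * N k z) ^+ 2.
    by apply: sumr_ge0 => k _; exact: sqr_ge0.
  have sq t : \sum_k (b k z - t * N k z) ^+ 2 =
     bb + (- (2 * t) * (\sum_k N k z * b k z) + t ^+ 2 * \sum_k N k z * N k z).
    rewrite /bb !mulr_sumr -!big_split/=; apply: eq_bigr => k _.
    by ring.
  rewrite sq sum_N_sq// -/Nb.
  have : 0 <= Nb ^+ 2 * nu z ^+ 2 by rewrite mulr_ge0// sqr_ge0.
  by move=> ? ?; lra.
have nq := nu_q Uz; rewrite -/qq in nq; rewrite -/Nb NbE.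
rewrite NbE in NbB.
have E : nu z ^+ 2 * qq = 1 - nu z ^+ 2 by rewrite expr2; lra.
have -> : alpha ^+ 2 * qq + 2 * alpha * qb + bb - (nu z * (alpha * qq + qb)) ^+ 2
  = alpha ^+ 2 * qq * (1 - nu z ^+ 2 * qq) +
    2 * alpha * qb * (1 - nu z ^+ 2 * qq) + (bb - (nu z * qb) ^+ 2) by ring.
rewrite E.
have -> : alpha ^+ 2 * qq * (1 - (1 - nu z ^+ 2)) =
  alpha ^+ 2 * (nu z ^+ 2 * qq) by ring.
rewrite E; lra.
Qed.

Lemma divergence_weighted_grad_barrier z : U z ->
  nu z * \sum_k partial k (weighted_grad phi k) z =
  nu z * alpha * H z - H z * (\sum_j N j z * b j z)
  + 2 * nu z * (\sum_j b j z * \sum_i N i z * B i j)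
  + (\sum_k partial k (b k) z)
  - \sum_k \sum_j N k z * N j z * partial k (b j) z.
Proof.
move=> Uz; have nu0 := nu_gt0 Uz; have nuN0 := lt0r_neq0 nu0.
have dN k := N_diff k Uz; have dn := nu_diff Uz.
have db k := b_diff k Uz; have dq k := q_diff k Uz.
have dqb j : differentiable (fun y => q j y * b j y) z.
  exact: (differentiable_mul (dq j) (db j)).
have ds := differentiable_big dqb.
have nV := differentiableV dn nuN0.
pose qb := \sum_j q j z * b j z.
pose NP k := \sum_i N i z * partial k (q i) z.
have Wk k : partial k (weighted_grad phi k) z =
    alpha * partial k (N k) z + NP k * b k z + (nu z)^-1 * partial k (b k) z
    - (\sum_j (N k z * b j z * partial k (q j) z + N k z * q j z * partial k (b j) z))
    - qb * partial k (N k) z.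
  rewrite (@partial_eq _ _ U _ _ k z oU Uz (weighted_grad_barrier k)).
  have d1 := differentiable_mul (differentiable_cst alpha z) (dN k).
  have d2 := differentiable_mul nV (db k).
  have d3 := differentiable_mul (dN k) ds.
  rewrite (partial_add _ (differentiable_add d1 d2) (differentiable_opp d3)).
  rewrite (partial_add _ d1 d2) (partial_opp _ d3) (partial_mull _ _ (dN k)).
  rewrite (partial_mul _ nV (db k)) (partial_mul _ (dN k) ds) (partial_big _ dqb).
  rewrite (partial_inv _ dn nuN0) partial_nu// -/(NP k) -/qb.
  have -> : N k z * (\sum_j partial k (fun y => q j y * b j y) z) =
    \sum_j (N k z * b j z * partial k (q j) z + N k z * q j z * partial k (b j) z).
    rewrite mulr_sumr; apply: eq_bigr => j _.
    by rewrite (partial_mul _ (dq j) (db j)); ring.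
  by field.
under eq_bigr do rewrite Wk.
rewrite !sumrB !big_split/= -!mulr_sumr divergence_N//.
have -> : \sum_k \sum_j (N k z * b j z * partial k (q j) z +
     N k z * q j z * partial k (b j) z) =
   (\sum_j b j z * \sum_k N k z * partial k (q j) z) +
   (nu z)^-1 * \sum_k \sum_j N k z * N j z * partial k (b j) z.
  under eq_bigr do rewrite big_split/=.
  rewrite big_split/=; congr (_ + _).
    rewrite exchange_big/=; apply: eq_bigr => j _; rewrite mulr_sumr.
    by apply: eq_bigr => k _; ring.
  rewrite mulr_sumr; apply: eq_bigr => k _; rewrite mulr_sumr.
  by apply: eq_bigr => j _; rewrite (N_def j); field.
(* The derivative of 1 / nu and the derivative of q . b produce the same first derivatives of [q]
   with exchanged indices and opposite signs; only the curl is left. *)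
have -> : \sum_j b j z * (\sum_i N i z * B i j) =
   2^-1 * ((\sum_k NP k * b k z) - \sum_j b j z * \sum_k N k z * partial k (q j) z).
  rewrite -sumrB mulr_sumr; apply: eq_bigr => j _.
  rewrite /NP [_ * b j z]mulrC -mulrBr [RHS]mulrCA; congr (_ * _).
  rewrite -sumrB mulr_sumr; apply: eq_bigr => i _.
  by rewrite (curl_q i j Uz); field.
have -> : \sum_j N j z * b j z = nu z * qb.
  by rewrite /qb mulr_sumr; apply: eq_bigr => j _; rewrite N_def mulrA.
by field.
Qed.

(** The operator applied to exp (K phi) - 1 yields the gradient term with weight K^2 and the
    Laplacian with weight only K, both multiplied by exp (K phi). This disparity is what a large [K]
    exploits; [0 <= phi z] ensures that the exponential is at least 1. *)
Lemma barrier_at_max z (K C0 C1 C2 : R) : U z -> 0 <= alpha -> 0 <= K ->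
  0 <= phi z ->
  (forall y, U y -> (expR (K * phi y) - 1) * (nu y)^-1 <=
                    (expR (K * phi z) - 1) * (nu z)^-1) ->
  - (\sum_l N l z * partial l H z) + 4 * \sum_k (\sum_l N l z * B l k) ^+ 2
    <= C0 -> 0 <= C0 ->
  - C1 <= nu z * \sum_k partial k (weighted_grad phi k) z ->
  - C2 <= \sum_j N j z * b j z ->
  K ^+ 2 * (alpha ^+ 2 * (1 - nu z ^+ 2) - 2 * alpha * nu z * C2)
    <= K * C1 + C0.
Proof.
move=> Uz al0 K0 phi0 fz hC0 C00 hC1 hC2; have nu0 := nu_gt0 Uz.
have phi2 : diff2_on U phi.
  split=> // i; apply: (@diff_on_eq _ _ U oU (fun y => alpha * q i y + b i y)).
    by move=> y Uy; rewrite grad_phi.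
  move=> y Uy; apply: differentiable_add; last exact: b_diff.
  exact: (differentiable_mul (differentiable_cst _ _) (q_diff i Uy)).
pose E y := expR (K * phi y) - 1.
have Kphi : diff2_on U (fun y => K * phi y).
  by apply: diff2_on_mul => //; exact: diff2_on_const.
have expd y : U y -> is_derive (K * phi y) 1 expR (expR (K * phi y)).
  by move=> _; exact: is_derive_expR.
have exp_diff : diff_on U (fun y => expR (K * phi y)).
  by move=> y Uy; apply: differentiable_comp1; [exact: derivable_expR|exact: Kphi.1].
have E2 : diff2_on U E.
  apply: (diff2_on_add oU); last exact: (diff2_on_const oU).
  exact: (@diff2_on_comp _ _ U oU expR expR _ expd exp_diff Kphi).
have f2 : diff2_on U (fun y => E y * (nu y)^-1).
  apply: diff2_on_mul => //; apply: diff2_on_inv => // y Uy.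
  exact: lt0r_neq0 (nu_gt0 Uy).
have Ef y : U y -> E y = E y * (nu y)^-1 * nu y.
  by move=> Uy; rewrite divfK// lt0r_neq0// nu_gt0.
have M := divergence_weighted_grad_at_max Uz f2 Ef fz.
have pE i y : U y -> partial i E y = expR (K * phi y) * (K * partial i phi y).
  move=> Uy; have dK := Kphi.1 y Uy.
  rewrite (partial_add _ (exp_diff y Uy) (differentiable_cst _ _)).
  rewrite [X in _ + X]partial_const addr0.
  rewrite (partial_comp1 _ (expd y Uy) dK); congr (_ * _).
  exact: (partial_mull _ _ (phi_diff Uy)).
have WE k y : U y -> weighted_grad E k y =
    expR (K * phi y) * (K * weighted_grad phi k y).
  move=> Uy; rewrite /weighted_grad pE//.
  have -> : \sum_j N j y * partial j E y =
      expR (K * phi y) * (K * \sum_j N j y * partial j phi y).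
    by rewrite !mulr_sumr; apply: eq_bigr => j _; rewrite pE//; ring.
  by ring.
have Wz : \sum_k partial k (weighted_grad E k) z =
    expR (K * phi z) * (K * (K * (\sum_k partial k phi z * weighted_grad phi k z)
      + \sum_k partial k (weighted_grad phi k) z)).
  rewrite [K * \sum_k _]mulr_sumr -big_split/= !mulr_sumr; apply: eq_bigr => k _.
  rewrite (@partial_eq _ _ U _ _ k z oU Uz (WE k)).
  have dW := weighted_grad_diff k phi2 Uz.
  have dKW := differentiable_mul (differentiable_cst K z) dW.
  rewrite (partial_mul _ (exp_diff z Uz) dKW) (partial_mull _ _ dW).
  rewrite (partial_comp1 _ (expd z Uz) (Kphi.1 z Uz)).
  by rewrite (partial_mull _ _ (phi_diff Uz))/=; ring.
rewrite [leLHS]Wz in M.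
have Lnu := le_trans (divergence_weighted_grad_nu_le Uz) hC0.
have G := barrier_gradient_ge Uz.
apply: (barrier_max_arith _ nu0 al0 K0 C00 hC2 G hC1 Lnu M).
by rewrite -expR0 ler_expR mulr_ge0.
Qed.

End Barrier.

End Operator.

(** * The interior bound *)

Lemma ler_norm_sum_card (R : realType) (d : nat) (F : 'I_d -> R) (c : R) :
  (forall i, `|F i| <= c) -> `|\sum_i F i| <= d%:R * c.
Proof.
move=> Fc; apply: le_trans (ler_norm_sum _ _ _) _.
apply: (@le_trans _ _ (\sum_(i < d) c)); first exact: ler_sum.
by rewrite sumr_const card_ord mulr_natl.
Qed.

Lemma ler_normM_bound (R : realType) (x y a b : R) : `|x| <= a -> `|y| <= b ->
  `|x * y| <= a * b.
Proof. by move=> xa yb; rewrite normrM ler_pM. Qed.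

Section BarrierConstants.
Variables (R : realType) (d alpha h beta beta1 gamma : R).

(** [d] is the dimension, [h] bounds [H] and its partials, [beta] the entries of [B], [beta1] the
    components of [b] and [gamma] their partials. The next three constants are the [C0], [C2] and
    [C1] of [barrier_at_max], in this order, estimated term by term. *)
Definition curvature_const := d * h + 4 * (d * (d * beta) ^+ 2).
Definition drift_const := d * beta1.
Definition barrier_const := alpha * h + h * drift_const
  + 2 * (d * (beta1 * (d * beta))) + d * gamma + d * (d * gamma).
(** Chosen so that half of K alpha^2 exceeds C1 + C0 + 1; the leading 1 gives K >= 1 and hence K C0
    >= C0. *)
Definition barrier_exponent :=
  1 + 2 * (barrier_const + curvature_const + 1) / alpha ^+ 2.
(** Below this value alpha^2 nu^2 and 2 alpha nu C2 are each at most alpha^2 / 4, so the gradient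
    term keeps at least alpha^2 / 2. *)
Definition nu_threshold := Num.min (1 / 2) (alpha / (8 * (drift_const + 1))).

Hypotheses (d0 : 0 <= d) (alpha_gt0 : 0 < alpha) (h0 : 0 <= h)
  (beta0 : 0 <= beta) (beta10 : 0 <= beta1) (gamma0 : 0 <= gamma).

Lemma curvature_const_ge0 : 0 <= curvature_const.
Proof. by rewrite addr_ge0// !mulr_ge0// sqr_ge0. Qed.

Lemma drift_const_ge0 : 0 <= drift_const.
Proof. exact: mulr_ge0. Qed.

Lemma barrier_const_ge0 : 0 <= barrier_const.
Proof. by rewrite !addr_ge0// !mulr_ge0// ltW. Qed.

Lemma nu_threshold_gt0 : 0 < nu_threshold.
Proof.
rewrite lt_min divr_gt0//= divr_gt0// mulr_gt0// ltr_wpDl//.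
exact: drift_const_ge0.
Qed.

Lemma barrier_exponent_ge1 : 1 <= barrier_exponent.
Proof.
rewrite lerDl divr_ge0 ?sqr_ge0// mulr_ge0//.
by rewrite (addr_ge0 (addr_ge0 barrier_const_ge0 curvature_const_ge0)).
Qed.

Lemma nu_threshold_lt nu : 0 < nu ->
  barrier_exponent ^+ 2 * (alpha ^+ 2 * (1 - nu ^+ 2)
                           - 2 * alpha * nu * drift_const)
    <= barrier_exponent * barrier_const + curvature_const ->
  nu_threshold < nu.
Proof.
move=> nu0; rewrite ltNge; apply: contraL => nul; rewrite -ltNge.
move: nul; rewrite le_min => /andP[nu1 nu2].
have C2 := drift_const_ge0; have C1 := barrier_const_ge0.
have C0 := curvature_const_ge0; have K1 := barrier_exponent_ge1.
have a2 : 0 < alpha ^+ 2 by rewrite exprn_gt0.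
have Ka : barrier_exponent * alpha ^+ 2 =
    alpha ^+ 2 + 2 * (barrier_const + curvature_const + 1).
  by rewrite /barrier_exponent; field; rewrite gt_eqF.
move: barrier_exponent drift_const barrier_const curvature_const Ka C2 C1 C0 K1 nu2.
move=> K C2 C1 C0 Ka C20 C10 C00 K1.
rewrite ler_pdivlMr ?mulr_gt0// ?ltr_wpDl// => nu2.
have e1 : alpha ^+ 2 * nu ^+ 2 <= alpha ^+ 2 / 4.
  rewrite ler_pM2l//; nra.
have e2 : 2 * alpha * nu * C2 <= alpha ^+ 2 / 4.
  have : alpha * (nu * (8 * (C2 + 1))) <= alpha * alpha by rewrite ler_pM2l.
  have : 0 < alpha * nu by rewrite mulr_gt0.
  by rewrite expr2; nra.
have e3 : alpha ^+ 2 / 2 <= alpha ^+ 2 * (1 - nu ^+ 2) - 2 * alpha * nu * C2.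
  by rewrite mulrBr mulr1; lra.
have K0 : 0 < K by apply: lt_le_trans K1.
apply: (@lt_le_trans _ _ (K ^+ 2 * (alpha ^+ 2 / 2))); last first.
  by rewrite ler_pM2l// exprn_gt0.
have -> : K ^+ 2 * (alpha ^+ 2 / 2) = K * ((K * alpha ^+ 2) / 2) by ring.
rewrite Ka.
have : K * (C1 + C0 + 1) <= K * ((alpha ^+ 2 + 2 * (C1 + C0 + 1)) / 2).
  by rewrite ler_pM2l//; lra.
apply: lt_le_trans.
nra.
Qed.

End BarrierConstants.

Section BarrierAtMax.
Variables (R : realType) (n : nat).
Notation V := 'rV[R]_(n + n).
Notation I := 'I_(n + n).
Notation d := ((n + n)%:R : R).

(** However steep the graph is, |N|^2 + nu^2 = 1 bounds [nu] and every [N i] by 1; hence all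
    hypotheses of [barrier_at_max] hold with constants independent of the slope. *)
Lemma nu_at_max_gt (U : set V) (q : I -> V -> R) (nu H : V -> R)
    (B : 'M[R]_(n + n)) (N : I -> V -> R) (phi : V -> R) (b : I -> V -> R)
    (z : V) (alpha h beta beta1 gamma : R) :
  graph_on U q nu H B N -> diff_on U phi -> (forall i, diff_on U (b i)) ->
  (forall i y, U y -> partial i phi y = alpha * q i y + b i y) ->
  U z -> 0 < alpha -> 0 <= h -> 0 <= beta -> 0 <= beta1 -> 0 <= gamma ->
  0 <= phi z ->
  (forall y, U y ->
     (expR (barrier_exponent d alpha h beta beta1 gamma * phi y) - 1) * (nu y)^-1
     <= (expR (barrier_exponent d alpha h beta beta1 gamma * phi z) - 1)
        * (nu z)^-1) ->
  `|H z| <= h -> (forall i, `|partial i H z| <= h) ->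
  (forall i j, `|B i j| <= beta) -> (forall i, `|b i z| <= beta1) ->
  (forall i j, `|partial i (b j) z| <= gamma) ->
  nu_threshold d alpha beta1 < nu z.
Proof.
move=> G dphi db gphi Uz al0 h0 be0 be10 ga0 phi0 fz Hh dHh Bb bb dbg.
have nu0 := graph_nu_gt0 G Uz; have d0 : 0 <= d by [].
have sN := sum_N_sq G Uz.
have N1 i : `|N i z| <= 1.
  rewrite -(@ler_sqr _ `|_|) ?nnegrE// expr1n real_normK ?num_real//.
  have : N i z * N i z <= \sum_i N i z * N i z.
    rewrite (bigD1 i)//= lerDl sumr_ge0// => j _.
    by rewrite -expr2 sqr_ge0.
  rewrite sN -expr2; have := sqr_ge0 (nu z); lra.
have nu2 : nu z ^+ 2 <= 1.
  by rewrite -subr_ge0 -sN sumr_ge0// => j _; rewrite -expr2 sqr_ge0.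
have nu1 : nu z <= 1 by rewrite leNgt; apply/negP => nu1; nra.
have nuN : `|nu z| <= 1 by rewrite gtr0_norm.
have NBb j : `|\sum_i N i z * B i j| <= d * beta.
  apply: ler_norm_sum_card => i; rewrite -[beta]mul1r; exact: ler_normM_bound.
have Nbb : `|\sum_j N j z * b j z| <= drift_const d beta1.
  apply: ler_norm_sum_card => i; rewrite -[beta1]mul1r; exact: ler_normM_bound.
apply: (@nu_threshold_lt _ d alpha h beta beta1 gamma) => //.
apply: (barrier_at_max G dphi db gphi Uz (ltW al0) _ phi0 fz).
- apply: le_trans ler01 _; exact: barrier_exponent_ge1.
- apply: lerD.
    apply: le_trans (ler_norm _) _; rewrite normrN.
    apply: ler_norm_sum_card => i; rewrite -[h]mul1r; exact: ler_normM_bound.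
  rewrite ler_pM2l//; apply: le_trans (ler_norm _) _.
  apply: ler_norm_sum_card => i; rewrite normrX lerXn2r ?nnegrE//.
  by rewrite mulr_ge0.
- exact: curvature_const_ge0.
- rewrite (divergence_weighted_grad_barrier G db gphi Uz).
  suff : `|nu z * alpha * H z - H z * (\sum_j N j z * b j z)
    + 2 * nu z * (\sum_j b j z * \sum_i N i z * B i j)
    + (\sum_k partial k (b k) z)
    - \sum_k \sum_j N k z * N j z * partial k (b j) z|
    <= barrier_const d alpha h beta beta1 gamma by rewrite ler_norml => /andP[].
  apply: le_trans (ler_normB _ _) _; apply: lerD; last first.
    apply: ler_norm_sum_card => k; apply: ler_norm_sum_card => j.
    rewrite -[gamma]mul1r; apply: ler_normM_bound => //.
    by rewrite -[1]mulr1; exact: ler_normM_bound.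
  apply: le_trans (ler_normD _ _) _; apply: lerD; last exact: ler_norm_sum_card.
  apply: le_trans (ler_normD _ _) _; apply: lerD; last first.
    apply: ler_normM_bound.
      by rewrite normrM ger0_norm// -[leRHS]mulr1 ler_pM.
    apply: ler_norm_sum_card => j; exact: ler_normM_bound.
  apply: le_trans (ler_normB _ _) _; apply: lerD; last exact: ler_normM_bound.
  apply: ler_normM_bound => //.
  by rewrite -[leRHS]mul1r normrM (gtr0_norm al0) ler_pM// ltW.
- by move: Nbb; rewrite ler_norml => /andP[].
Qed.

Lemma norm_le_sum_sq (x : V) : `|x| ^+ 2 <= \sum_i x 0 i ^+ 2.
Proof.
have s0 : 0 <= \sum_i x 0 i ^+ 2 by apply: sumr_ge0 => i _; exact: sqr_ge0.
rewrite -[leRHS]sqr_sqrtr// lerXn2r ?nnegrE ?sqrtr_ge0//.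
apply: rV_norm_le => [|i]; first exact: sqrtr_ge0.
rewrite -sqrtr_sqr ler_wsqrtr// (bigD1 i)//= lerDl sumr_ge0// => j _.
exact: sqr_ge0.
Qed.

Lemma interior_nu_bound (e r M m h beta : R) :
  0 < e -> 0 < r -> 0 <= M -> 0 <= m -> 0 <= h -> 0 <= beta ->
  exists C : R, 0 < C /\
  forall (Om : set V) (z0 : V) (q : I -> V -> R) (nu H : V -> R)
    (B : 'M[R]_(n + n)) (N : I -> V -> R) (u : V -> R) (X : I -> V -> R),
  graph_on Om q nu H B N -> (forall y, `|y - z0| <= r -> Om y) ->
  diff_on Om u -> (forall i, diff_on Om (X i)) ->
  (forall i y, Om y -> partial i u y = e * q i y - X i y) ->
  (forall y, `|y - z0| <= r -> `|u y| <= M) ->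
  (forall y, `|y - z0| <= r -> `|H y| <= h) ->
  (forall i y, `|y - z0| <= r -> `|partial i H y| <= h) ->
  (forall i y, `|y - z0| <= r -> `|X i y| <= m) ->
  (forall i j y, `|y - z0| <= r -> `|partial i (X j) y| <= 1) ->
  (forall i j, `|B i j| <= beta) ->
  (nu z0)^-1 <= C.
Proof.
move=> e0 r0 M0 m0 h0 be0.
(* The oscillation of [u] is at most 2 M, so [a] times it stays below 1. The factor [e] in [alpha]
   comes from Du = e q - X. *)
pose a := (2 * M + 1)^-1; pose alpha := a * e.
have M1 : 0 < 2 * M + 1 by rewrite ltr_wpDl// mulr_ge0.
have a0 : 0 < a by rewrite invr_gt0.
have a1 : a <= 1 by rewrite invf_le1//; lra.
have aM : a * (2 * M) < 1 by rewrite mulrC ltr_pdivrMr// mul1r; lra.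
have al0 : 0 < alpha by rewrite mulr_gt0.
(* [beta1] and [gamma] bound [D phi - alpha q] and its derivatives. *)
pose beta1 := m + 4 / r; pose gamma := 1 + 4 / r ^+ 2.
have r2 : 0 < r ^+ 2 by rewrite exprn_gt0.
have be10 : 0 <= beta1 by rewrite addr_ge0// divr_ge0// ltW.
have ga0 : 0 <= gamma by rewrite addr_ge0// divr_ge0// ltW.
pose K := barrier_exponent d alpha h beta beta1 gamma.
pose nu0 := nu_threshold d alpha beta1.
have d0 : 0 <= d by [].
have K1 : 1 <= K by exact: barrier_exponent_ge1.
have nu00 : 0 < nu0 by exact: nu_threshold_gt0.
have K0 : 0 < K by apply: lt_le_trans K1.
have eK : 0 < expR K - 1 by rewrite subr_gt0 expR_gt1.
(* With f = (exp (K phi) - 1) / nu, the value (exp K - 1) / nu(z0) at [z0] is at most the maximum,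
   which is at most exp (2 K) / nu0. *)
exists (expR (2 * K) / nu0 / (expR K - 1)); split.
  by rewrite !divr_gt0// expR_gt0.
move=> Om z0 q nu H B N u X G Br du dX gu uM Hh dHh Xm dXm Bb.
(* [c2] is the coefficient of the quadratic part of the barrier and [c4], its double, that of the
   gradient of this part. *)
have [c2 c2E] : exists c : R, c = - (2 / r ^+ 2) by eexists.
have [c4 c4E] : exists c : R, c = - (4 / r ^+ 2) by eexists.
have c4n : `|c4| = 4 / r ^+ 2 by rewrite c4E normrN gtr0_norm ?divr_gt0.
pose phi (y : V) : R := 1 + c2 * (\sum_i (y 0 i - z0 0 i) * (y 0 i - z0 0 i))
   + a * (u y - u z0).
pose b i (y : V) : R := - a * X i y + c4 * (y 0 i - z0 0 i).
have dc i y : differentiable (fun y : V => y 0 i - z0 0 i) y.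
  exact: (differentiable_add (differentiable_coordinate i y)
    (differentiable_cst _ _)).
have pc i j y : partial i (fun y : V => y 0 j - z0 0 j) y = (i == j)%:R.
  rewrite (partial_add _ (differentiable_coordinate j y)
    (differentiable_cst _ _)).
  by rewrite partial_coordinate [X in _ + X]partial_const addr0.
have dc2 i y : differentiable (fun y : V =>
    (y 0 i - z0 0 i) * (y 0 i - z0 0 i)) y.
  exact: (differentiable_mul (dc i y) (dc i y)).
have dquad y : differentiable (fun y : V =>
    1 + c2 * (\sum_i (y 0 i - z0 0 i) * (y 0 i - z0 0 i))) y.
  exact: (differentiable_add (differentiable_cst _ _)
    (differentiable_mul (differentiable_cst _ _) (differentiable_big
       (fun i => dc2 i y)))).
have duc y : Om y -> differentiable (fun y => u y - u z0) y.
  by move=> Oy; exact: (differentiable_add (du y Oy) (differentiable_cst _ _)).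
have dphi : diff_on Om phi.
  move=> y Oy; exact: (differentiable_add (dquad y)
    (differentiable_mul (differentiable_cst _ _) (duc y Oy))).
have db i : diff_on Om (b i).
  move=> y Oy; exact: (differentiable_add
    (differentiable_mul (differentiable_cst _ _) (dX i y Oy))
    (differentiable_mul (differentiable_cst _ _) (dc i y))).
have pb i j y : Om y -> partial i (b j) y =
    - a * partial i (X j) y + c4 * (i == j)%:R.
  move=> Oy; rewrite (partial_add _
    (differentiable_mul (differentiable_cst _ _) (dX j y Oy))
    (differentiable_mul (differentiable_cst _ _) (dc j y))).
  by rewrite (partial_mull _ _ (dX j y Oy)) (partial_mull _ _ (dc j y)) pc.
have gphi i y : Om y -> partial i phi y = alpha * q i y + b i y.
  move=> Oy; rewrite (partial_add _ (dquad y)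
    (differentiable_mul (differentiable_cst _ _) (duc y Oy))).
  rewrite (partial_mull _ _ (duc y Oy)).
  rewrite (partial_add _ (du y Oy) (differentiable_cst _ _)).
  rewrite [X in a * (_ + X)]partial_const addr0 gu//.
  rewrite (partial_add _ (differentiable_cst _ _)
    (differentiable_mul (differentiable_cst _ _) (differentiable_big
       (fun i => dc2 i y)))).
  rewrite [X in X + _ + _]partial_const add0r.
  rewrite (partial_mull _ _ (differentiable_big (fun i => dc2 i y))).
  rewrite (partial_big _ (fun i => dc2 i y)).
  have -> : \sum_k partial i (fun y : V =>
      (y 0 k - z0 0 k) * (y 0 k - z0 0 k)) y = 2 * (y 0 i - z0 0 i).
    rewrite (bigD1 i)//= big1 ?addr0 => [|k ki].
      by rewrite (partial_mul _ (dc i y) (dc i y)) pc eqxx mulr1 -mulr2n mulr_natl.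
    by rewrite (partial_mul _ (dc k y) (dc k y)) pc eq_sym (negbTE ki) mulr0 addr0.
  by rewrite /b /alpha c4E c2E; field; rewrite gt_eqF.
have phi_z0 : phi z0 = 1.
  rewrite /phi subrr mulr0 addr0 big1 ?mulr0 ?addr0// => i _.
  by rewrite subrr mulr0.
have z0r : `|z0 - z0| <= r by rewrite subrr normr0 ltW.
have uu y : `|y - z0| <= r -> a * (u y - u z0) <= a * (2 * M).
  move=> yr; rewrite ler_pM2l//.
  have := uM y yr; have := uM z0 z0r; rewrite !ler_norml => /andP[? ?] /andP[? ?].
  lra.
have sq0 (y : V) : 0 <= \sum_i (y 0 i - z0 0 i) * (y 0 i - z0 0 i).
  by apply: sumr_ge0 => i _; rewrite -expr2 sqr_ge0.
have phi2 y : `|y - z0| <= r -> phi y <= 2.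
  move=> yr; rewrite /phi c2E; have := uu y yr; have := sq0 y.
  have : 0 <= 2 / r ^+ 2 by rewrite divr_ge0// ltW.
  move: (\sum_i _) (2 / r ^+ 2) => s c c0 s0 ay.
  have := mulr_ge0 c0 s0; lra.
(* Sup norm [r] forces the Euclidean square to be at least [r ^+ 2], so the quadratic part is at
   most -2 and outweighs 1 plus the contribution of [u]. *)
have phi_bd y : `|y - z0| <= r -> 0 < phi y -> `|y - z0| < r.
  move=> yr py; rewrite ltNge; apply/negP => ry; move: py.
  rewrite ltNge => /negP; apply; rewrite /phi c2E.
  have : r ^+ 2 <= `|y - z0| ^+ 2 by rewrite lerXn2r ?nnegrE// ltW.
  move=> /le_trans/(_ (norm_le_sum_sq (y - z0))).
  have -> : \sum_i (y - z0) 0 i ^+ 2 =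
      \sum_i (y 0 i - z0 0 i) * (y 0 i - z0 0 i).
    by apply: eq_bigr => i _; rewrite !mxE expr2.
  have := uu y yr; move: (\sum_i _) => s ay rs.
  have : 2 <= 2 / r ^+ 2 * s.
    by rewrite mulrAC ler_pdivlMr// ler_pM2l.
  lra.
pose A := [set y : V | `|y - z0| <= r].
have nuV y : Om y -> differentiable (fun y => (nu y)^-1) y.
  move=> Oy; apply: differentiableV; first exact: (graph_nu_diff2 G).1.
  exact: lt0r_neq0 (graph_nu_gt0 G Oy).
pose f (y : V) : R := (expR (K * phi y) - 1) * (nu y)^-1.
have df y : Om y -> differentiable f y.
  move=> Oy; have dK := differentiable_mul (differentiable_cst K y) (dphi y Oy).
  have dE : differentiable (fun y => expR (K * phi y)) y.
    by apply: differentiable_comp1 => //; exact: derivable_expR.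
  exact: (differentiable_mul (differentiable_add dE (differentiable_cst _ _))
    (nuV y Oy)).
have cA : compact A.
  have -> : A = closed_ball z0 r.
    by rewrite closed_ballE//; apply/seteqP; split=> y; rewrite /A /closed_ball_/= distrC.
  apply: bounded_closed_compact; last exact: closed_ball_closed.
  exists (`|z0| + r); split; first exact: num_real.
  move=> x xr y; rewrite closed_ballE// /closed_ball_/= => yr.
  rewrite (le_trans _ (ltW xr))// -[y](subrK z0) addrC.
  by rewrite (le_trans (ler_normD _ _))// lerD2l distrC.
have A0 : A !=set0 by exists z0.
have cf : {within A, continuous f}.
  apply: continuous_in_subspaceT => y /set_mem Ay.
  exact/differentiable_continuous/df/Br.
have [z /set_mem Az fz] := EVT_max_rV A0 cA cf.
have {}fz y : `|y - z0| <= r -> f y <= f z by move=> yr; apply/fz/mem_set.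
have nuz := graph_nu_gt0 G (Br z Az).
have nuz0 := graph_nu_gt0 G (Br z0 z0r).
have fz0 := fz z0 z0r; rewrite /f phi_z0 mulr1 in fz0.
(* Positivity of the value at [z0] passes to the maximum, hence to [phi z], which keeps [z] off the
   boundary of the box. *)
have Ez : 0 < expR (K * phi z) - 1.
  have : 0 < (expR (K * phi z) - 1) / nu z.
    by apply: lt_le_trans fz0; rewrite divr_gt0.
  by rewrite pmulr_lgt0// invr_gt0.
have phiz : 0 < phi z.
  by move: Ez; rewrite subr_gt0 expR_gt1 pmulr_rgt0.
have zr := phi_bd z Az phiz.
pose U := ball z0 r.
have UE y : U y -> `|y - z0| <= r.
  by rewrite /U -ball_normE/= distrC => /ltW.
have sU : U `<=` Om by move=> y /UE /Br.
have oU : open U by exact: ball_open.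
have Uz : U z by rewrite /U -ball_normE/= distrC.
have nuz_gt : nu0 < nu z.
  apply: (@nu_at_max_gt U q nu H B N phi b z alpha h beta beta1 gamma) => //.
  - exact: graph_on_sub sU G.
  - by move=> y /sU /dphi.
  - by move=> i y /sU; exact: db.
  - by move=> i y /sU; exact: gphi.
  - exact: ltW.
  - by move=> y /UE /fz.
  - exact: Hh.
  - by move=> i; exact: dHh.
  - move=> i; rewrite /b; apply: le_trans (ler_normD _ _) _; apply: lerD.
      rewrite -[leRHS]mul1r; apply: ler_normM_bound; last exact: Xm.
      by rewrite normrN gtr0_norm.
    have -> : 4 / r = 4 / r ^+ 2 * r by field; rewrite gt_eqF.
    apply: ler_normM_bound; first by rewrite c4n.
    apply: le_trans Az.
    by have := rV_coord_norm (z - z0) i; rewrite !mxE.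
  - move=> i j; rewrite pb//; last exact: Br.
    apply: le_trans (ler_normD _ _) _; apply: lerD.
      rewrite -[leRHS]mul1r; apply: ler_normM_bound; last exact: dXm.
      by rewrite normrN gtr0_norm.
    rewrite -[leRHS]mulr1; apply: ler_normM_bound; first by rewrite c4n.
    by case: (i == j); rewrite ?normr0 ?normr1.
have : (expR K - 1) / nu z0 <= expR (2 * K) / nu0.
  apply: le_trans fz0 _; apply: ler_pM.
  - exact: ltW.
  - by rewrite invr_ge0 ltW.
  - apply: (@le_trans _ _ (expR (K * phi z))); first by rewrite gerBl.
    by rewrite ler_expR mulrC ler_pM2r// phi2.
  - by rewrite lef_pV2 ?posrE// ltW.
by rewrite [leLHS]mulrC -ler_pdivlMr.
Qed.

End BarrierAtMax.

(** * Euclidean geometry and the contact form *)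

Section Euclidean.
Variables (R : realType) (n : nat).
Notation V := 'rV[R]_(n + n).
Notation I := 'I_(n + n).
Notation d := ((n + n)%:R : R).
Implicit Types (v w z : V) (A : set V).

Lemma enorm_ge0 v : 0 <= enorm v.
Proof. exact: sqrtr_ge0. Qed.

Lemma enorm_sq v : enorm v ^+ 2 = \sum_i v 0 i * v 0 i.
Proof.
rewrite sqr_sqrtr; first by apply: eq_bigr => i _; rewrite expr2.
by apply: sumr_ge0 => i _; exact: sqr_ge0.
Qed.

Lemma norm_le_enorm v : `|v| <= enorm v.
Proof.
rewrite -(@ler_pXn2r _ 2) ?nnegrE ?enorm_ge0// sqr_sqrtr; last first.
  by apply: sumr_ge0 => i _; exact: sqr_ge0.
exact: norm_le_sum_sq.
Qed.

Lemma coord_le_enorm v i : `|v 0 i| <= enorm v.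
Proof. exact: le_trans (rV_coord_norm v i) (norm_le_enorm v). Qed.

Lemma enorm_le_norm v : enorm v <= d * `|v|.
Proof.
have dv : 0 <= d * `|v| by rewrite mulr_ge0.
rewrite -(@ler_pXn2r _ 2) ?nnegrE ?enorm_ge0// enorm_sq.
apply: le_trans (ler_norm _) _.
apply: (@le_trans _ _ (d * (`|v| * `|v|))).
  by apply: ler_norm_sum_card => i; apply: ler_normM_bound; exact: rV_coord_norm.
rewrite exprMn expr2 ler_wpM2r ?sqr_ge0// -natrM ler_nat.
by case: (n + n)%N => // k; rewrite leq_pmulr.
Qed.

Lemma enorm_le v (c : R) : 0 <= c -> (forall i, `|v 0 i| <= c) ->
  enorm v <= d * c.
Proof.
move=> c0 vc; apply: le_trans (enorm_le_norm v) _.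
by rewrite ler_wpM2l// rV_norm_le.
Qed.

Lemma enormZ (a : R) v : enorm (a *: v) = `|a| * enorm v.
Proof.
rewrite -sqrtr_sqr -sqrtrM ?sqr_ge0// mulr_sumr; congr Num.sqrt.
by apply: eq_bigr => i _; rewrite mxE exprMn.
Qed.

(** If the segment avoided the boundary, its trace on [A] would be open and closed in it, nonempty
    and proper, against connectedness. *)
Lemma segment_meets_boundary A z w : open A -> A z -> ~ A w ->
  exists2 t : R, 0 <= t <= 1 & boundary A (z + t *: (w - z)).
Proof.
move=> oA Az Aw; pose g (t : R) : V := z + t *: (w - z).
apply: contrapT => nb.
have nb' t : 0 <= t <= 1 -> closure A (g t) -> A (g t).
  move=> t01 cl; apply: contrapT => nA; apply: nb; exists t => //; split=> //.
  by move=> iA; apply: nA; exact: interior_subset iA.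
have cg : continuous g.
  move=> t; apply: cvgD; first exact: cvg_cst.
  exact: scalel_continuous.
have cS : connected (g @` `[0, 1]).
  apply: connected_continuous_connected; first exact: segment_connected.
  exact: continuous_subspaceT.
have gS t : 0 <= t <= 1 -> (g @` `[0, 1]) (g t).
  by move=> t01; exists t => //=; rewrite in_itv.
have g0 : g 0 = z by rewrite /g scale0r addr0.
have g1 : g 1 = w by rewrite /g scale1r addrCA subrr addr0.
have E : g @` `[0, 1] `&` A = g @` `[0, 1].
  apply: cS.
  - by exists (g 0); split; [apply: gS; rewrite lexx ler01|rewrite g0].
  - by exists A.
  - exists (closure A); first exact: closed_closure.
    apply/seteqP; split=> y [[t t01 <-] Ay]; split; try by exists t.
      exact: subset_closure.
    by apply: nb' => //; move: t01; rewrite /= in_itv.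
apply: Aw; rewrite -g1.
have : (g @` `[0, 1]) (g 1) by apply: gS; rewrite ler01 lexx.
by rewrite -[X in X _]E => -[].
Qed.

Lemma set_dist_le (A B : set V) p q : A p -> B q ->
  set_dist A B <= enorm (p - q).
Proof.
move=> Ap Bq; apply: ge_inf.
  by exists 0 => x [a Aa [b Bb <-]]; exact: enorm_ge0.
by exists p => //; exists q.
Qed.

(** Only the distance between the two boundaries is given. A segment from [z] to a point outside [B]
    leaves both sets, and its two boundary points are no further apart than its ends. *)
Lemma near_set_dist_boundary (A B : set V) z y :
  open A -> open B -> closure A `<=` B -> A z ->
  enorm (y - z) < set_dist (boundary A) (boundary B) -> B y.
Proof.
move=> oA oB AB Az yz; apply: contrapT => By.
have Ay : ~ A y by move=> /(@subset_closure _ A) /AB.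
have Bz : B z by apply/AB/subset_closure.
have [s s01 bs] := segment_meets_boundary oA Az Ay.
have [t t01 bt] := segment_meets_boundary oB Bz By.
have := set_dist_le bs bt; apply/negP; rewrite -ltNge; apply: le_lt_trans yz.
have -> : z + s *: (y - z) - (z + t *: (y - z)) = (s - t) *: (y - z).
  by rewrite scalerBl opprD addrACA subrr add0r.
rewrite enormZ ler_piMl ?enorm_ge0// ler_norml.
case/andP: s01 => ? ?; case/andP: t01 => ? ?; apply/andP; split; lra.
Qed.

Lemma compact_subset_ball (A B : set V) : compact A -> open B -> A `<=` B ->
  exists2 r : R, 0 < r & forall a y, A a -> `|y - a| < r -> B y.
Proof.
move=> cA oB AB.
have := (compact_near_coveringP A).1 cA R (nbhs (0 : R))
   (fun r x => forall y, `|y - x| < r -> B y) _.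
case=> [x Ax|r /= r0 Hr].
  have [e e0 He] := near_norm (open_nbhs_nbhs (conj oB (AB x Ax))).
  exists (ball x (e / 2), ball (0 : R) (e / 2)) => /=.
    by split; apply: nbhsx_ballx; rewrite divr_gt0.
  move=> [x' r'] /= [xx' r'0] y yx'.
  rewrite -(subrK x y); apply: He.
  rewrite -(subrKA x') (le_lt_trans (ler_normD _ _))// (splitr e) ltrD//.
    apply: lt_trans yx' _; move: r'0; rewrite -ball_normE/= sub0r normrN.
    exact: le_lt_trans (ler_norm _).
  by move: xx'; rewrite -ball_normE/= distrC.
exists (r / 2); first by rewrite divr_gt0.
move=> a y Aa; apply: Hr => //.
by rewrite /= sub0r normrN gtr0_norm ?divr_gt0//; lra.
Qed.

(** As [inf] of the empty set is 0, both boundaries must be shown nonempty: in positive dimension a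
    bounded [B] misses some point [w], and the segments towards [w] cross them. Compactness then
    gives a uniform gap. *)
Lemma set_dist_boundary_gt0 (A B : set V) : (0 < n)%N ->
  open A -> open B -> A !=set0 -> ebounded B -> compact (closure A) ->
  closure A `<=` B -> 0 < set_dist (boundary A) (boundary B).
Proof.
move=> n0 oA oB [z Az] [M BM] cA AB.
have n2 : (0 < n + n)%N by rewrite addn_gt0 n0.
pose i0 : I := Ordinal n2.
pose w : V := (`|M| + 1) *: delta_mx 0 i0.
have Bw : ~ B w.
  move=> /BM /(le_trans (coord_le_enorm w i0)); rewrite !mxE !eqxx mulr1.
  by rewrite ger0_norm ?addr_ge0//; have := ler_norm M; lra.
have Bz : B z by apply/AB/subset_closure.
have Aw : ~ A w by move=> /(@subset_closure _ A) /AB.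
have [s _ bs] := segment_meets_boundary oA Az Aw.
have [t _ bt] := segment_meets_boundary oB Bz Bw.
have [r r0 rB] := compact_subset_ball cA oB AB.
apply: lt_le_trans r0 _; apply: lb_le_inf.
  by exists (enorm (z + s *: (w - z) - (z + t *: (w - z))));
    exists (z + s *: (w - z)) => //; exists (z + t *: (w - z)).
move=> x [a [Aa _] [b [_ Bb] <-]]; rewrite leNgt; apply/negP => abr.
apply: Bb; rewrite (proj1 (interior_id B))//; apply: (rB a) => //.
by rewrite distrC; exact: le_lt_trans (norm_le_enorm _) abr.
Qed.

End Euclidean.

(** * Suprema over compactly contained sets *)

Section SupNorm.
Variables (R : realType) (n : nat).
Notation V := 'rV[R]_(n + n).
Notation I := 'I_(n + n).
Variables (Om A : set V).
Hypothesis AOm : cc A Om.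

Lemma compact_norm_bound (f : V -> R) :
  (forall z, Om z -> {for z, continuous f}) ->
  exists M : R, forall z, A z -> `|f z| <= M.
Proof.
move=> cf; have [cA AO] := AOm.
have cfA : {within closure A, continuous f}.
  by apply: continuous_in_subspaceT => y /set_mem /AO; exact: cf.
have /compact_bounded[M [_ Mf]] := continuous_compact cfA cA.
exists (M + 1) => z Az; apply: (Mf (M + 1)); first by rewrite ltrDl.
by exists z => //; exact: subset_closure.
Qed.

(** [sup] dominates a set only when the set is bounded above; compactness of the closure of [A]
    inside [Om] supplies this. *)
Lemma le_supnorm (f : V -> R) : (forall z, Om z -> {for z, continuous f}) ->
  forall z, A z -> `|f z| <= supnorm A f.
Proof.
move=> /compact_norm_bound[M fM] z Az; apply: ub_le_sup; last by exists z.
by exists M => x [y Ay <-]; exact: fM.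
Qed.

Lemma le_supnormV (F : V -> V) :
  (forall i z, Om z -> {for z, continuous (fun w => F w 0 i)}) ->
  forall z, A z -> enorm (F z) <= supnormV A F.
Proof.
move=> cF z Az; apply: ub_le_sup; last by exists z.
pose M i := sval (cid (compact_norm_bound (cF i))).
have FM i y : A y -> `|F y 0 i| <= M i.
  by move=> Ay; exact: (svalP (cid (compact_norm_bound (cF i))) y).
exists ((n + n)%:R * \sum_i `|M i|) => x [y Ay <-].
apply: enorm_le; first exact: sumr_ge0.
move=> i; apply: le_trans (FM i y Ay) _; apply: le_trans (ler_norm _) _.
by rewrite (bigD1 i)//= lerDl sumr_ge0.
Qed.

Lemma supnorm_ge0 (f : V -> R) z : A z ->
  (forall z, Om z -> {for z, continuous f}) -> 0 <= supnorm A f.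
Proof. by move=> Az cf; apply: le_trans (le_supnorm cf Az). Qed.

Lemma supnormV_ge0 (F : V -> V) z : A z ->
  (forall i z, Om z -> {for z, continuous (fun w => F w 0 i)}) ->
  0 <= supnormV A F.
Proof.
by move=> Az cF; apply: le_trans (enorm_ge0 _) (le_supnormV cF Az).
Qed.

End SupNorm.

Section Contact.
Variables (R : realType) (n : nat).
Notation V := 'rV[R]_(n + n).
Notation I := 'I_(n + n).

(** The standard symplectic matrix, as the constant Jacobian of [Xfield]: the row is the direction
    of differentiation, the column the component. *)
Definition contact_mx : 'M[R]_(n + n) :=
  \matrix_(k, i) match fintype.split i with
                 | inl j => - (k == rshift n j)%:R
                 | inr j => (k == lshift n j)%:R
                 end.

Lemma contact_mx_skew i j : contact_mx i j = - contact_mx j i.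
Proof.
rewrite !mxE; case: (split_ordP i) => i' ->; case: (split_ordP j) => j' ->.
- by rewrite !eq_lrshift !oppr0.
- by rewrite eq_lshift eq_rshift opprK eq_sym.
- by rewrite eq_lshift eq_rshift eq_sym.
- by rewrite !eq_rlshift oppr0.
Qed.

Lemma contact_mx_le1 i j : `|contact_mx i j| <= 1.
Proof.
rewrite mxE; case: fintype.split => k; rewrite ?normrN;
  by case: (_ == _); rewrite ?normr0 ?normr1.
Qed.

Lemma differentiable_Xfield i (z : V) :
  differentiable (fun w : V => Xfield w 0 i) z.
Proof.
have -> : (fun w : V => Xfield w 0 i) = (fun w : V =>
    match fintype.split i with
    | inl j => - w 0 (rshift n j)
    | inr j => w 0 (lshift n j)
    end) by apply/funext => w; rewrite mxE.
case: fintype.split => j; last exact: differentiable_coordinate.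
exact: (differentiable_opp (differentiable_coordinate _ _)).
Qed.

Lemma partial_Xfield k i (z : V) :
  partial k (fun w : V => Xfield w 0 i) z = contact_mx k i.
Proof.
have -> : (fun w : V => Xfield w 0 i) = (fun w : V =>
    match fintype.split i with
    | inl j => - w 0 (rshift n j)
    | inr j => w 0 (lshift n j)
    end) by apply/funext => w; rewrite mxE.
rewrite mxE; case: fintype.split => j; last by rewrite partial_coordinate.
by rewrite (partial_opp _ (differentiable_coordinate _ _)) partial_coordinate.
Qed.

End Contact.

Section Regularity.
Variables (R : realType) (n : nat).
Notation V := 'rV[R]_(n + n).
Variable Om : set V.
Hypothesis oOm : open Om.

Lemma Ck_continuous k (f : V -> R) : Ck k Om f ->
  forall z, Om z -> {for z, continuous f}.
Proof. by case: k => [|k] //= []. Qed.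

Lemma Ck_diff_on k (f : V -> R) : Ck k.+1 Om f -> diff_on Om f.
Proof.
move=> [_ [df Cf]] z Oz; apply: (C1_differentiable oOm Oz) => [i y Oy|i].
  exact: df.
exact: Ck_continuous (Cf i) z Oz.
Qed.

Lemma Ck_partial k (f : V -> R) i : Ck k.+1 Om f -> Ck k Om (partial i f).
Proof. by move=> [_ [_]]; exact. Qed.

Lemma Ck_diff2_on k (f : V -> R) : Ck k.+2 Om f -> diff2_on Om f.
Proof.
by move=> Cf; split=> [|i]; [exact: Ck_diff_on Cf|
  exact: Ck_diff_on (Ck_partial i Cf)].
Qed.

End Regularity.

(** * The solution as a graph with prescribed mean curvature *)

Section HorizontalGraph.
Variables (R : realType) (n : nat).
Notation V := 'rV[R]_(n + n).
Notation I := 'I_(n + n).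
Variables (eps : R) (Om : set V) (u H : V -> R).
Hypothesis eps0 : eps != 0.
Hypothesis oOm : open Om.
Hypothesis Cu : Ck 3 Om u.

Let e : R := `|eps|.
Let p i (z : V) := partial i u z + Xfield z 0 i.
Let s (z : V) := eps ^+ 2 + \sum_i p i z * p i z.
Let W z := Num.sqrt (s z).
Definition horizontal_slope i z := e^-1 * p i z.
Definition vertical_normal z := e * (W z)^-1.
(** Written exactly as the field under the divergence in the equation, so that its divergence is [H]
    by hypothesis; its form nu q is derived in [horizontal_graph_on]. *)
Definition horizontal_normal i z :=
  ((Num.sqrt (eps ^+ 2 + enorm (grad u z + Xfield z) ^+ 2))^-1
     *: (grad u z + Xfield z)) 0 i.

Let e_gt0 : 0 < e. Proof. by rewrite normr_gt0. Qed.

Let s_gt0 z : 0 < s z.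
Proof.
rewrite ltr_pwDl ?exprn_even_gt0//.
by apply: sumr_ge0 => i _; rewrite -expr2 sqr_ge0.
Qed.

Let W_gt0 z : 0 < W z. Proof. by rewrite sqrtr_gt0. Qed.

Let p_diff2 i : diff2_on Om (p i).
Proof.
apply: (diff2_on_add oOm); first exact: Ck_diff2_on (Ck_partial i Cu).
split=> [z _|k]; first exact: differentiable_Xfield.
apply: (@diff_on_eq _ _ Om oOm (fun _ => contact_mx R n k i)).
  by move=> z _; rewrite partial_Xfield.
by move=> z _; exact: differentiable_cst.
Qed.

Let s_diff2 : diff2_on Om s.
Proof.
apply: (diff2_on_add oOm); first exact: diff2_on_const.
by apply: (diff2_on_sum oOm) => i; exact: (diff2_on_mul oOm).
Qed.

Let W_diff2 : diff2_on Om W.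
Proof.
apply: (@diff2_on_comp _ _ Om oOm Num.sqrt (fun x => (2 * Num.sqrt x)^-1) s) => //.
  by move=> y _; exact: is_derive1_sqrt.
move=> y Oy; apply: differentiableV; last first.
  by rewrite mulf_neq0// gt_eqF// W_gt0.
apply: (differentiable_mul (differentiable_cst _ _)).
apply: differentiable_comp1; last exact: s_diff2.1.
by have [] := is_derive1_sqrt (s_gt0 y).
Qed.

Lemma vertical_normal_le z i : `|p i z| <= e * (vertical_normal z)^-1.
Proof.
rewrite /vertical_normal invfM invrK mulrA mulfV ?gt_eqF// mul1r.
rewrite -sqrtr_sqr ler_wsqrtr// /s (bigD1 i)//= -expr2 addrCA lerDl.
rewrite addr_ge0 ?sqr_ge0//.
by apply: sumr_ge0 => j _; rewrite -expr2 sqr_ge0.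
Qed.

(** Second derivatives of [u] cancel in the curl of [q], which leaves the curl of [X] divided by
    |eps|. Skewness of [contact_mx] doubles a single entry, with the indices in the order that
    explains the transpose. *)
Lemma horizontal_graph_on :
  (forall z, Om z ->
     div (fun w => (Num.sqrt (eps ^+ 2 + enorm (grad u w + Xfield w) ^+ 2))^-1
                    *: (grad u w + Xfield w)) z = H z) ->
  graph_on Om horizontal_slope vertical_normal H (e^-1 *: (contact_mx R n)^T)
    horizontal_normal.
Proof.
move=> mean.
have e2 : e * e = eps ^+ 2 by rewrite -expr2 real_normK ?num_real.
have en0 : e != 0 by rewrite gt_eqF.
have qE i j y : Om y -> partial j (horizontal_slope i) y =
    e^-1 * (partial j (partial i u) y + contact_mx R n j i).
  move=> Oy; rewrite (partial_mull _ _ ((p_diff2 i).1 y Oy)); congr (_ * _).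
  rewrite (partial_add _ (Ck_diff_on oOm (Ck_partial i Cu) Oy)
    (differentiable_Xfield i y)).
  by rewrite partial_Xfield.
have BE i j : (e^-1 *: (contact_mx R n)^T) i j = e^-1 * contact_mx R n j i.
  by rewrite [LHS]mxE; congr (_ * _); rewrite [LHS]mxE.
split=> //.
- by move=> i; apply: (diff2_on_mul oOm) => //; exact: diff2_on_const.
- apply: (diff2_on_mul oOm); first exact: diff2_on_const.
  by apply: (diff2_on_inv oOm) => // y _; rewrite gt_eqF.
- by move=> y _; rewrite mulr_gt0// invr_gt0.
- move=> y _; rewrite /vertical_normal.
  have -> : \sum_i horizontal_slope i y * horizontal_slope i y =
      (e * e)^-1 * \sum_i p i y * p i y.
    rewrite mulr_sumr; apply: eq_bigr => i _; rewrite /horizontal_slope.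
    by field.
  have W2 : W y * W y = s y by rewrite -expr2 sqr_sqrtr// ltW.
  have -> : 1 + (e * e)^-1 * (\sum_i p i y * p i y) = (e * e)^-1 * (W y * W y).
    by rewrite W2 /s -e2; field.
  by field; rewrite en0 gt_eqF.
- by move=> i j; rewrite !BE contact_mx_skew mulrN.
- move=> i j y Oy; rewrite !qE// (partial_schwarz oOm i j Oy (Ck_diff2_on oOm Cu)).
  rewrite BE (contact_mx_skew R i j).
  by ring.
- move=> i y; rewrite /horizontal_normal mxE enorm_sq.
  have pE j : (grad u y + Xfield y) 0 j = p j y by rewrite mxE [X in X + _]mxE.
  under eq_bigr do rewrite pE.
  rewrite pE -/(s y) -/(W y) /vertical_normal /horizontal_slope.
  by field; rewrite en0 gt_eqF.
Qed.

End HorizontalGraph.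

Theorem theorem1p2 (R : realType) (n : nat) (hn : (0 < n)%N)
    (eps : R) (heps : eps != 0) (delta Mu MH MX : R) :
  exists C : R, 0 < C /\
  forall (Om Omt Omh : set 'rV[R]_(n + n)) (H u : 'rV[R]_(n + n) -> R),
    domain Om -> ebounded Om ->
    Ck 1 Om H -> Ck 3 Om u ->
    (forall z, Om z ->
       div (fun w => (Num.sqrt (eps ^+ 2 + enorm (grad u w + Xfield w) ^+ 2))^-1
                      *: (grad u w + Xfield w)) z = H z) ->
    domain Omt -> cc Omt Om ->
    domain Omh -> cc Omh Omt ->
    set_dist (boundary Omh) (boundary Omt) = delta ->
    supnorm Omt u = Mu ->
    C1norm Omt H = MH ->
    supnormV Omt (@Xfield R n) = MX ->
    forall z, Omh z -> enorm (grad u z) <= C.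
Proof.
(* The distance between the boundaries is always positive, so for [delta <= 0] there is no
   configuration and any constant will do. *)
have [delta0|delta0] := ltP 0 delta; last first.
  exists 1; split=> // Om Omt Omh H u dOm [M bOm] _ _ _ dOmt [_ tO] dOmh [ch ht] hd.
  exfalso; move: delta0; rewrite -hd leNgt => /negP; apply.
  apply: set_dist_boundary_gt0 => //; [exact: dOmh.1|exact: dOmt.1|exact: dOmh.2.2|].
  by exists M => y ty; apply/bOm/tO/subset_closure.
have e0 : 0 < `|eps| by rewrite normr_gt0.
have d0 : 0 < (n + n)%:R + 1 :> R by rewrite ltr_wpDl.
have r0 : 0 < delta / ((n + n)%:R + 1) by rewrite divr_gt0.
(* The Euclidean norm is at most the dimension times the sup norm; the extra 1 in the denominator
   makes the box of radius [r] lie strictly within distance [delta]. *)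
set r := delta / _ in r0.
have be0 : 0 <= `|eps|^-1 by rewrite invr_ge0.
(* The prescribed norms are arbitrary reals at this point, hence the absolute values. *)
have [C0 [C00 bound]] := @interior_nu_bound R n `|eps| r `|Mu| `|MX| `|MH| `|eps|^-1
  e0 r0 (normr_ge0 _) (normr_ge0 _) (normr_ge0 _) be0.
(* Each partial derivative of [u] is a component of Du + X, at most |eps| / nu, minus one of [X];
   the dimension passes from components to the Euclidean norm. *)
exists ((n + n)%:R * (`|eps| * C0 + `|MX|)); split.
  rewrite mulr_gt0 ?ltr0n ?addn_gt0 ?hn// ltr_pwDl// mulr_gt0//.
move=> Om Omt Omh H u dOm bOm CH Cu mean dOmt tO dOmh ht hd hMu hMH hMX z hz.
have oOm := dOm.1; have sub y : Omt y -> Om y.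
  by move=> ty; apply/tO.2/subset_closure.
have ball_sub y : `|y - z| <= r -> Omt y.
  move=> yr; apply: (near_set_dist_boundary dOmh.1 dOmt.1 ht.2 hz).
  rewrite hd (le_lt_trans (enorm_le_norm _))//.
  apply: (@le_lt_trans _ _ ((n + n)%:R * r)); first by rewrite ler_wpM2l.
  by rewrite /r mulrA ltr_pdivrMr// mulrC ltr_pM2l// ltrDl.
have zt : Omt z by apply: ball_sub; rewrite subrr normr0 ltW.
have cu := Ck_continuous Cu.
have uM y : Omt y -> `|u y| <= `|Mu|.
  by move=> ty; rewrite (le_trans (le_supnorm tO cu ty))// hMu ler_norm.
have cX i y : Om y -> {for y, continuous (fun w => Xfield w 0 i)}.
  by move=> _; apply/differentiable_continuous/differentiable_Xfield.
have XM i y : Omt y -> `|Xfield y 0 i| <= `|MX|.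
  move=> ty; rewrite (le_trans (coord_le_enorm _ i))//.
  by rewrite (le_trans (le_supnormV tO cX ty))// hMX ler_norm.
have cH := Ck_continuous CH.
have cgH i y : Om y -> {for y, continuous (fun w => grad H w 0 i)}.
  have -> : (fun w => grad H w 0 i) = partial i H.
    by apply/funext => w; rewrite mxE.
  exact: Ck_continuous (Ck_partial i CH) y.
have HM y : Omt y -> `|H y| <= `|MH|.
  move=> ty; rewrite (le_trans (le_supnorm tO cH ty))//.
  by rewrite (le_trans _ (ler_norm _))// -hMH lerDl (supnormV_ge0 tO ty).
have dHM i y : Omt y -> `|partial i H y| <= `|MH|.
  move=> ty; have -> : partial i H y = grad H y 0 i by rewrite mxE.
  rewrite (le_trans (coord_le_enorm _ i))// (le_trans (le_supnormV tO cgH ty))//.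
  by rewrite (le_trans _ (ler_norm _))// -hMH lerDr (supnorm_ge0 tO ty).
have G := horizontal_graph_on heps oOm Cu mean.
have nub : (vertical_normal eps u z)^-1 <= C0.
  apply: (bound Om z _ _ _ _ _ u (fun i w => Xfield w 0 i) G).
  - by move=> y /ball_sub /sub.
  - exact: Ck_diff_on Cu.
  - by move=> i y _; exact: differentiable_Xfield.
  - by move=> i y _; rewrite /horizontal_slope mulVKf ?gt_eqF// addrK.
  - by move=> y /ball_sub /uM.
  - by move=> y /ball_sub /HM.
  - by move=> i y /ball_sub; exact: dHM.
  - by move=> i y /ball_sub; exact: XM.
  - by move=> i j y _; rewrite partial_Xfield contact_mx_le1.
  - move=> i j.
    have -> : (`|eps|^-1 *: (contact_mx R n)^T) i j =
        `|eps|^-1 * contact_mx R n j i.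
      by rewrite [LHS]mxE; congr (_ * _); rewrite [LHS]mxE.
    rewrite -[leRHS]mulr1; apply: ler_normM_bound; last exact: contact_mx_le1.
    by rewrite normfV normr_id.
apply: enorm_le => [|i]; first by rewrite addr_ge0// mulr_ge0// ltW.
have -> : grad u z 0 i = (partial i u z + Xfield z 0 i) - Xfield z 0 i.
  by rewrite [LHS]mxE addrK.
apply: le_trans (ler_normB _ _) _; apply: lerD; last exact: XM.
by rewrite (le_trans (vertical_normal_le u heps z i))// ler_wpM2l.
Qed.
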